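(* Let $C$ be a plane reduced curve and $P\in C$ a double point of $C$. Then $P$ is an $A_{2r}$ singularity if and only if no curvilinear scheme supported at $P$ of length $> 2r+1$ is contained in $C$. More precisely, (i) $P$ is an $A_{2r-1}$ singularity for $C$ if and only if for any $\ell \geq 1$ there is a curvilinear scheme supported at $P$ of length $\ell$ contained in $C$; (ii) $P$ is an $A_{2r}$ singularity if and only if for any $\ell \leq 2r+1$ there is a curvilinear scheme supported at $P$ of length $\ell$ contained in $C$, and no curvilinear scheme supported at $P$ of length $> 2r+1$ contained in $C$.
   Context: The ground field is $\mathbb{C}$. A singularity of type $A_s$ of a plane curve is a double point which, writing $s=2m-\varepsilon$ with $m$ a positive integer and $\varepsilon\in\{0,1\}$, can be resolved via $m$ blow-ups and whose desingularization yields two points if $\varepsilon=1$ and only one if $\varepsilon=0$; at such a point the curve is analytically isomorphic to $y^2-x^{s+1}=0$ at the origin. The letters $r$ and $\ell$ denote positive integers. A curvilinear scheme supported at $P$ is a $0$-dimensional scheme in the plane, supported at $P$, which is contained in a plane curve smooth at $P$; it is contained in $C$ if it is a subscheme of $C$.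
   Formalization: In the first sentence and in (i), r is not fixed: ''A_{2r}'' (resp. ''A_{2r-1}'') means for some r ≥ 1, and the bound ''> 2r+1'' in the first sentence is for some r ≥ 1. With r fixed both fail: y²=x³ has no scheme of length > 5 but is not A_4; A_1 has all lengths but is not A_3. *)

(* Defs.v *)
From mathcomp Require Import all_boot all_order all_algebra.
From mathcomp Require Import complex reals.
From mathcomp Require Import mpoly.

Set Implicit Arguments.
Unset Strict Implicit.
Unset Printing Implicit Defensive.

Import GRing.Theory.
Local Open Scope ring_scope.

(* All the notions below are local at a point, so the plane is the affine     *)
(* plane over K: a curve is given by its equation f : {mpoly K[2]} and a      *)
(* point by its pair of coordinates P : 2.-tuple K.                           *)

Definition mdivides (K : fieldType) (g f : {mpoly K[2]}) : Prop :=
  exists h : {mpoly K[2]}, f = h * g.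

(* The coordinate ring K[x, y]/(f) has no nonzero nilpotent element.          *)
Definition reduced_curve (K : fieldType) (f : {mpoly K[2]}) : Prop :=
  (1 < msize f)%N /\
  forall (g : {mpoly K[2]}) (n : nat), mdivides f (g ^+ n) -> mdivides f g.

Definition translate (K : fieldType) (f : {mpoly K[2]}) (P : 2.-tuple K) :
    {mpoly K[2]} :=
  f \mPo [tuple (tnth P i)%:MP + 'X_i | i < 2].

(* n is the order of vanishing of f at P; n = 0 when P is not on the curve.   *)
Definition multiplicity_at (K : fieldType) (f : {mpoly K[2]}) (P : 2.-tuple K)
    (n : nat) : Prop :=
  (forall m : 'X_{1..2}, (mdeg m < n)%N -> (translate f P)@_m = 0) /\
  (exists2 m : 'X_{1..2}, mdeg m = n & (translate f P)@_m != 0).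

Definition smooth_at (K : fieldType) (f : {mpoly K[2]}) (P : 2.-tuple K) :
    Prop := multiplicity_at f P 1.

Definition double_point (K : fieldType) (f : {mpoly K[2]}) (P : 2.-tuple K) :
    Prop := multiplicity_at f P 2.

(* The exceptional line of the blow-up of the plane at P = (a, b) consists of *)
(* the tangent directions at P, represented by option K: Some t is the        *)
(* direction of slope t, that is the point (0, t) of the chart                *)
(*   (u, v) |-> (a + u, b + u v)    with exceptional line u = 0,              *)
(* and None is the vertical direction, that is the point (0, 0) of the chart  *)
(*   (u, v) |-> (a + u v, b + v)    with exceptional line v = 0.              *)
Definition blowup_chart (K : fieldType) (P : 2.-tuple K) (q : option K) :
    2.-tuple {mpoly K[2]} :=
  if q is Some _
  then [tuple (tnth P 0)%:MP + 'X_0; (tnth P 1)%:MP + 'X_0 * 'X_1]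
  else [tuple (tnth P 0)%:MP + 'X_0 * 'X_1; (tnth P 1)%:MP + 'X_1].

Definition exc_line (K : fieldType) (q : option K) : {mpoly K[2]} :=
  if q is Some _ then 'X_0 else 'X_1.

Definition exc_point (K : fieldType) (q : option K) : 2.-tuple K :=
  if q is Some t then [tuple 0; t] else [tuple 0; 0].

Definition strict_transform (K : fieldType) (f : {mpoly K[2]}) (P : 2.-tuple K)
    (q : option K) (g : {mpoly K[2]}) : Prop :=
  (exists n : nat, f \mPo blowup_chart P q = exc_line q ^+ n * g) /\
  ~ mdivides (exc_line q) g.

(* resolves f P m k: the curve f = 0 is desingularized over its point P by    *)
(* exactly m blow-ups, each one centred at a singular point (P or infinitely  *)
(* near to P), and the desingularization has k points over P. In the second   *)
(* clause g q is the strict transform in the chart containing q, and s        *)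
(* enumerates the points of the strict transform lying over P.                *)
Inductive resolves (K : fieldType) (f : {mpoly K[2]}) (P : 2.-tuple K) :
    nat -> nat -> Prop :=
| resolves_smooth : smooth_at f P -> resolves f P 0 1
| resolves_blowup (n : nat) (g : option K -> {mpoly K[2]})
    (s : seq (option K)) (m k : option K -> nat) :
    multiplicity_at f P n -> (1 < n)%N ->
    (forall q, strict_transform f P q (g q)) ->
    uniq s ->
    (forall q, q \in s <-> (g q).@[tnth (exc_point q)] = 0) ->
    (forall q, q \in s -> resolves (g q) (exc_point q) (m q) (k q)) ->
    resolves f P (1 + \sum_(q <- s) m q)%N (\sum_(q <- s) k q)%N.

(* s = 2 m - e with e in {0, 1} and m > 0; m blow-ups are needed, and there   *)
(* are two points over P if e = 1, only one if e = 0.                         *)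
Definition A_singularity (K : fieldType) (f : {mpoly K[2]}) (P : 2.-tuple K)
    (s : nat) : Prop :=
  double_point f P /\
  exists (m : nat) (e : bool),
    [/\ (0 < m)%N, s = (2 * m - e)%N & resolves f P m (1 + e)%N].

(* A closed subscheme of the plane is given by the ideal of the polynomials   *)
(* vanishing on it.                                                           *)
Definition is_ideal (K : fieldType) (I : {mpoly K[2]} -> Prop) : Prop :=
  [/\ I 0, forall g h, I g -> I h -> I (g + h) & forall g h, I h -> I (g * h)].

Definition supported_at (K : fieldType) (I : {mpoly K[2]} -> Prop)
    (P : 2.-tuple K) : Prop :=
  forall Q : 2.-tuple K, (forall g, I g -> g.@[tnth Q] = 0) <-> Q = P.

(* The scheme is 0-dimensional of length l: K[x, y]/I has dimension l over K, *)
(* the classes of b_0, ..., b_(l-1) being a basis.                            *)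
Definition has_length (K : fieldType) (I : {mpoly K[2]} -> Prop) (l : nat) :
    Prop :=
  exists b : 'I_l -> {mpoly K[2]},
    forall g : {mpoly K[2]},
      exists! c : 'rV[K]_l, I (g - \sum_(i < l) c 0 i *: b i).

Definition curvilinear_scheme (K : fieldType) (I : {mpoly K[2]} -> Prop)
    (P : 2.-tuple K) (l : nat) : Prop :=
  [/\ is_ideal I, supported_at I P, has_length I l
    & exists2 g : {mpoly K[2]}, smooth_at g P & I g].

(* A scheme with ideal I is a subscheme of the curve f = 0 iff f is in I.     *)
Definition contains_curvilinear (K : fieldType) (f : {mpoly K[2]})
    (P : 2.-tuple K) (l : nat) : Prop :=
  exists2 I : {mpoly K[2]} -> Prop, curvilinear_scheme I P l & I f.

(* Main.v *)
Require Import Defs.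
From HB Require Import structures.
From mathcomp Require Import all_boot all_order all_algebra.
From mathcomp Require Import complex reals separable.
From mathcomp Require Import mpoly ring zify.
From Stdlib Require Import Classical.

Set Implicit Arguments.
Unset Strict Implicit.
Unset Printing Implicit Defensive.

Import GRing.Theory.
Local Open Scope ring_scope.

(** A curvilinear scheme of length l >= 1 at P contained in f = 0 is the same
thing as a smooth parametrized arc through P along which f vanishes to order at
least l ([contains_has_arc]): the ideal of such a scheme contains the equation
of a smooth curve, hence that of a graph, and a scheme of length l on a graph is
cut out by the l-th power of the parameter. So the theorem is about the orders
of contact that smooth arcs can have with f at P.

These orders are computed by blowing up. Put P at the origin and let G be the
strict transform of f at a point t of the exceptional line, so that
f(x, x (t + y)) = x^2 G(x, y). An arc transversal to the exceptional line that
has contact l with G is mapped to a smooth arc that has contact l + 2 with f;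
conversely an arc of contact at least 3 with f is tangent to a tangent line of
f, and lifts to such an arc. Hence ([tangent_cases]):
- if f has two tangents, G is smooth at both points and transversal arcs of any
  contact exist there, by Hensel's lemma, so all orders occur for f;
- if f has one tangent and G is smooth, then G is tangent to the exceptional
  line, and the largest contact with f is 3;
- if f has one tangent and G is singular, then G has again a double point, and
  passing from G to f raises the largest contact by exactly 2.
By induction ([resolves_arcs]), when d blow-ups resolve the double point, every
order occurs if there are two points over P, and exactly the orders up to
2 d + 1 occur if there is one. These two behaviours exclude each other and
determine d in the second case, so all the equivalences follow as soon as every
double point of a reduced curve is resolved, with one or two points over it.

For that, suppose that m blow-ups do not suffice. Pushing down arcs from the
last double point gives a smooth arc along which f and both its partial
derivatives vanish to order m ([resolves_or_singular_arc]). But f is reduced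
and the characteristic is 0, so f is separable as a polynomial in y over the
rational functions in x: the ideal (f, f_y) contains a nonzero polynomial in x
([reduced_discriminant]), and likewise (f, f_x) contains one in y. One of the
two coordinates is a local parameter of the arc, and the polynomial in this
coordinate vanishes to an order that does not depend on the arc; this bounds m
([singular_arc_bound]). *)

(** * Evaluation of bivariate polynomials *)

Section Evaluation.
Variable K : fieldType.

(** K[x, y] is generated by x and y as a K-algebra; this is how every compatibility
of evaluation maps below is proved. *)
Lemma mpoly2_ind (Q : {mpoly K[2]} -> Prop) :
  (forall c, Q c%:MP) -> Q 'X_0 -> Q 'X_1 ->
  (forall g h, Q g -> Q h -> Q (g + h)) ->
  (forall g h, Q g -> Q h -> Q (g * h)) -> forall h, Q h.
Proof.
move=> QC Q0 Q1 QD QM; have QX n g : Q g -> Q (g ^+ n).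
  move=> Qg; elim: n => [|n IHn]; first by rewrite expr0 -mpolyC1.
  by rewrite exprS; apply: QM.
elim/mpolyind => [|c m h _ _ Qh]; first by rewrite -mpolyC0.
apply: QD Qh; rewrite -mul_mpolyC; apply: (QM) (QC c) _.
rewrite mpolyXE_id !big_ord_recl big_ord0 mulr1.
by apply: QM; apply: QX; rewrite // (_ : lift _ _ = 1) //; apply: val_inj.
Qed.

(** Evaluation in an arbitrary algebra, because the same polynomials are evaluated at
scalars, along arcs (in K[T]) and at coordinate changes (in K[x, y]). *)
Definition ev (A : comAlgType K) (a b : A) : {mpoly K[2]} -> A :=
  mmap (in_alg A) (fun i : 'I_2 => if i == 0 then a else b).

HB.instance Definition _ (A : comAlgType K) (a b : A) :=
  GRing.RMorphism.copy (ev a b) (ev a b).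

Lemma evC (A : comAlgType K) (a b : A) c : ev a b c%:MP = c%:A.
Proof. exact: mmapC. Qed.

Lemma ev_scalable (A : comAlgType K) (a b : A) : scalable (ev a b).
Proof. by move=> c h; rewrite -mul_mpolyC rmorphM /= evC mulr_algl. Qed.

HB.instance Definition _ (A : comAlgType K) (a b : A) :=
  GRing.isScalable.Build K {mpoly K[2]} A _ (ev a b) (ev_scalable a b).

Lemma evX0 (A : comAlgType K) (a b : A) : ev a b 'X_0 = a.
Proof. by rewrite /ev mmapX mmap1U. Qed.

Lemma evX1 (A : comAlgType K) (a b : A) : ev a b 'X_1 = b.
Proof. by rewrite /ev mmapX mmap1U. Qed.

Section Morphism.
Variables (A : comAlgType K) (a b : A).
Lemma evD : {morph ev a b : g h / g + h}. Proof. exact: rmorphD. Qed.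
Lemma evB : {morph ev a b : g h / g - h}. Proof. exact: rmorphB. Qed.
Lemma evN : {morph ev a b : g / - g}. Proof. exact: rmorphN. Qed.
Lemma evM : {morph ev a b : g h / g * h}. Proof. exact: rmorphM. Qed.
Lemma ev0 : ev a b 0 = 0. Proof. exact: rmorph0. Qed.
Lemma ev1 : ev a b 1 = 1. Proof. exact: rmorph1. Qed.
Lemma evXn n : {morph ev a b : g / g ^+ n}. Proof. exact: rmorphXn. Qed.
End Morphism.

Definition evE := (evX0, evX1, evC, evD, evB, evN, evM, ev0, ev1, evXn).

Lemma ev_morph (A B : comAlgType K) (phi : {lrmorphism A -> B}) a b h :
  phi (ev a b h) = ev (phi a) (phi b) h.
Proof.
elim/mpoly2_ind: h => [c|||g h IHg IHh|g h IHg IHh].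
- by rewrite !evC linearZ rmorph1.
- by rewrite !evX0.
- by rewrite !evX1.
- by rewrite !rmorphD /= IHg IHh.
- by rewrite !rmorphM /= IHg IHh.
Qed.

Lemma comp_mpoly_ev (h a b : {mpoly K[2]}) : h \mPo [tuple a; b] = ev a b h.
Proof.
elim/mpoly2_ind: h => [c|||g h IHg IHh|g h IHg IHh].
- by rewrite comp_mpolyC evC alg_mpolyC.
- by rewrite comp_mpolyXU evX0.
- by rewrite comp_mpolyXU evX1.
- by rewrite !rmorphD /= IHg IHh.
- by rewrite !rmorphM /= IHg IHh.
Qed.

Lemma ev_id h : ev ('X_0 : {mpoly K[2]}) 'X_1 h = h.
Proof.
elim/mpoly2_ind: h => [c|||g h IHg IHh|g h IHg IHh].
- by rewrite evC alg_mpolyC.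
- by rewrite evX0.
- by rewrite evX1.
- by rewrite !rmorphD /= IHg IHh.
- by rewrite !rmorphM /= IHg IHh.
Qed.

Lemma ev_ev (A : comAlgType K) (x y : A) (a b h : {mpoly K[2]}) :
  ev x y (ev a b h) = ev (ev x y a) (ev x y b) h.
Proof. exact: (ev_morph (ev x y)). Qed.

Lemma ev_comp (s a b : {poly K}) h : ev a b h \Po s = ev (a \Po s) (b \Po s) h.
Proof. exact: (ev_morph (comp_poly s)). Qed.

Lemma ev_const0 (a b : {poly K}) h :
  a.[0] = 0 -> b.[0] = 0 -> (ev a b h).[0] = h@_0.
Proof.
move=> a0 b0; elim/mpoly2_ind: h => [c|||g h IHg IHh|g h IHg IHh].
- by rewrite evC alg_polyC hornerC mcoeffC eqxx mulr1.
- by rewrite evX0 a0 mcoeffX mnm1_eq0.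
- by rewrite evX1 b0 mcoeffX mnm1_eq0.
- by rewrite (rmorphD (ev a b)) hornerD mcoeffD IHg IHh.
- by rewrite (rmorphM (ev a b)) hornerM (rmorphM (mcoeff 0%MM)) /= IHg IHh.
Qed.

Lemma meval_ev (v : 'I_2 -> K) h : h.@[v] = (ev (v 0)%:P (v 1)%:P h).[0].
Proof.
elim/mpoly2_ind: h => [c|||g h IHg IHh|g h IHg IHh].
- by rewrite evC alg_polyC hornerC mevalC.
- by rewrite evX0 mevalXU hornerC.
- by rewrite evX1 mevalXU hornerC.
- by rewrite (rmorphD (ev _ _)) hornerD mevalD IHg IHh.
- by rewrite (rmorphM (ev _ _)) hornerM mevalM IHg IHh.
Qed.

(** Both a perturbation estimate, when b - b' is divisible by a power of T, and, for
b = y and b' = p(x), the division of h by the equation of a graph. *)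
Lemma ev_taylor (A : comAlgType K) (a b b' : A) h :
  exists s : A, ev a b h - ev a b' h = (b - b') * s.
Proof.
elim/mpoly2_ind: h => [c|||g h [s IHg] [t IHh]|g h [s IHg] [t IHh]].
- by exists 0; rewrite !evC subrr mulr0.
- by exists 0; rewrite !evX0 subrr mulr0.
- by exists 1; rewrite !evX1 mulr1.
- by exists (s + t); rewrite !rmorphD mulrDr -IHg -IHh; ring.
- exists (s * ev a b h + ev a b' g * t); rewrite !rmorphM.
  rewrite (_ : (b - b') * _ = (b - b') * s * ev a b h + ev a b' g * ((b - b') * t)).
    by rewrite -IHg -IHh; ring.
  by ring.
Qed.

(** [horner_alg] scales its target through [in_alg]; as a linear map for the ordinary
scaling it becomes an instance of [{lrmorphism _ -> _}], as [ev_morph] requires. *)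
Definition peval (A : comAlgType K) (a : A) : {poly K} -> A := horner_alg a.

HB.instance Definition _ (A : comAlgType K) (a : A) :=
  GRing.RMorphism.copy (peval a) (peval a).

Lemma pevalC (A : comAlgType K) (a : A) c : peval a c%:P = c%:A.
Proof. exact: horner_algC. Qed.

Lemma pevalX (A : comAlgType K) (a : A) : peval a 'X = a.
Proof. exact: horner_algX. Qed.

Lemma peval_scalable (A : comAlgType K) (a : A) : scalable (peval a).
Proof. by move=> c q; rewrite -mul_polyC rmorphM /= pevalC mulr_algl. Qed.

HB.instance Definition _ (A : comAlgType K) (a : A) :=
  GRing.isScalable.Build K {poly K} A _ (peval a) (peval_scalable a).

Lemma peval_morph (A B : comAlgType K) (phi : {lrmorphism A -> B}) a q :
  phi (peval a q) = peval (phi a) q.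
Proof.
elim/poly_ind: q => [|q c IHq]; first by rewrite !rmorph0.
by rewrite !(rmorphD, rmorphM) /= IHq !pevalX !pevalC linearZ rmorph1.
Qed.

Lemma peval_comp (s q : {poly K}) : peval s q = q \Po s.
Proof.
elim/poly_ind: q => [|q c IHq]; first by rewrite !rmorph0.
by rewrite !(rmorphD, rmorphM) /= IHq pevalX pevalC comp_polyX comp_polyC alg_polyC.
Qed.

(** The symmetry of the two coordinates. It reduces the vertical tangent direction,
and arcs that are graphs over the second axis, to the other ones. *)
Definition swap : {mpoly K[2]} -> {mpoly K[2]} := ev 'X_1 'X_0.

Lemma ev_swap (A : comAlgType K) (a b : A) h : ev a b (swap h) = ev b a h.
Proof. by rewrite /swap ev_ev evX0 evX1. Qed.

Lemma swapK : involutive swap.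
Proof. by move=> h; rewrite {1}/swap ev_swap ev_id. Qed.

Lemma ev_taylorl (A : comAlgType K) (a a' b : A) h :
  exists s : A, ev a b h - ev a' b h = (a - a') * s.
Proof.
have [s es] := ev_taylor b a a' (swap h).
by exists s; rewrite -es !ev_swap.
Qed.

Lemma mderivXi (i j : 'I_2) : ('X_i : {mpoly K[2]})^`M(j) = (i == j)%:R.
Proof.
rewrite mderivX mnm1E; case: eqP => [->|_]; last exact: scale0r.
rewrite scale1r (_ : (_ - _)%MM = 0%MM) ?mpolyX0 //.
by apply/mnmP => k; rewrite mnmBE subnn mnm0E.
Qed.

Lemma mderiv_ev (i : 'I_2) (a b h : {mpoly K[2]}) :
  (ev a b h)^`M(i) =
  ev a b h^`M(0) * a^`M(i) + ev a b h^`M(1) * b^`M(i).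
Proof.
elim/mpoly2_ind: h => [c|||g h IHg IHh|g h IHg IHh].
- by rewrite evC alg_mpolyC !mderivC !rmorph0 !mul0r addr0.
- by rewrite evX0 !mderivXi ev1 ev0; ring.
- by rewrite evX1 !mderivXi ev1 ev0; ring.
- by rewrite evD !mderivD IHg IHh !evD; ring.
- rewrite evM !mderivM IHg IHh !(evD, evM).
  move: (ev a b g) (ev a b h) (ev a b g^`M(0)) (ev a b g^`M(1)) (ev a b h^`M(0)) => *.
  ring.
Qed.

End Evaluation.

(** * Orders of vanishing at the origin *)

Section Order.
Variable K : fieldType.
Implicit Types (f g h F G : {mpoly K[2]}) (P : 2.-tuple K).

(** The maximal ideal of the origin is generated by x and y. *)
Lemma mpoly2_split h :
  exists h1 h2, h = (h@_0)%:MP + 'X_0 * h1 + 'X_1 * h2.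
Proof.
elim/mpoly2_ind: h => [c|||g h [g1 [g2 eg]] [h1 [h2 eh]]|g h [g1 [g2 eg]] [h1 [h2 eh]]].
- by exists 0, 0; rewrite mcoeffC eqxx mulr1 !mulr0 !addr0.
- by exists 1, 0; rewrite mcoeffX mnm1_eq0 mpolyC0; ring.
- by exists 0, 1; rewrite mcoeffX mnm1_eq0 mpolyC0; ring.
- exists (g1 + h1), (g2 + h2); rewrite mcoeffD mpolyCD {1}eg {1}eh; ring.
- exists (g1 * h + (g@_0)%:MP * h1), (g2 * h + (g@_0)%:MP * h2).
  rewrite (rmorphM (mcoeff 0%MM)) mpolyCM {1}eg mulrDl mulrDl {1}eh /=; ring.
Qed.

Lemma mcoeffXiM (i : 'I_2) h m :
  ('X_i * h)@_m = if (0 < m i)%N then h@_(m - U_(i)) else 0.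
Proof.
case: ifP => [mi|/negbT].
  by rewrite mulrC -{1}(@submK _ U_(i) m) ?lep1mP -?lt0n // addmC mcoeffMX.
rewrite -eqn0Ngt => /eqP mi; rewrite [h]mpolyE mulr_sumr raddf_sum big1 //= => k _.
rewrite -scalerAr -mpolyXD mcoeffZ mcoeffX; case: eqP => [ek|_]; last exact: mulr0.
by move: mi; rewrite -ek mnmDE mnm1E eqxx.
Qed.

Lemma mcoeff0XiM (i : 'I_2) h : ('X_i * h)@_0 = 0.
Proof. by rewrite mcoeffXiM mnm0E. Qed.

Lemma mcoeff0_peval (i : 'I_2) (q : {poly K}) : (peval 'X_i q)@_0 = q.[0].
Proof.
elim/poly_ind: q => [|q c _]; first by rewrite rmorph0 mcoeff0 horner0.
rewrite rmorphD rmorphM /= pevalX pevalC alg_mpolyC.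
by rewrite mulrC mcoeffD mcoeff0XiM mcoeffC eqxx mulr1 hornerMXaddC mulr0.
Qed.

Lemma mcoeff0_swap h : (swap h)@_0 = h@_0.
Proof. by rewrite -!(@ev_const0 _ 0 0) ?ev_swap ?horner0. Qed.

Definition vanishes_to n h := forall m, (mdeg m < n)%N -> h@_m = 0.

Lemma vanishes_toD n g h :
  vanishes_to n g -> vanishes_to n h -> vanishes_to n (g + h).
Proof. by move=> vg vh m mn; rewrite mcoeffD vg ?vh ?addr0. Qed.

Lemma vanishes_toX n (i : 'I_2) h :
  vanishes_to n h -> vanishes_to n.+1 ('X_i * h).
Proof.
move=> vh m mn; rewrite mcoeffXiM; case: ifP => // mi; apply: vh.
by move: mn; rewrite -{1}(@submK _ U_(i) m) ?lep1mP -?lt0n // mdegD mdeg1 addn1.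
Qed.

Lemma vanishes_to1 h : h@_0 = 0 -> vanishes_to 1 h.
Proof. by move=> h0 m; rewrite ltnS leqn0 mdeg_eq0 => /eqP->. Qed.

(** The linear part of F at the origin is l x + m y, and F(0, 0) = 0. Stated as
membership in the ideal (x, y), not through coefficients, since the cofactors
can be substituted into. *)
Definition linpart F l m := exists h1 h2,
  [/\ F = 'X_0 * h1 + 'X_1 * h2, h1@_0 = l & h2@_0 = m].

(** Likewise: F lies in the square of (x, y), with quadratic part
a x^2 + b x y + c y^2. *)
Definition quadpart F a b c := exists h1 h2 h3,
  [/\ F = 'X_0 * ('X_0 * h1) + 'X_0 * ('X_1 * h2) + 'X_1 * ('X_1 * h3),
      h1@_0 = a, h2@_0 = b & h3@_0 = c].

Lemma vanishes1_linpart F : F@_0 = 0 -> exists l m, linpart F l m.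
Proof.
have [h1 [h2 e]] := mpoly2_split F; move=> F0; exists h1@_0, h2@_0, h1, h2.
by split=> //; rewrite {1}e F0 mpolyC0 add0r.
Qed.

Lemma linpart_quadpart F : linpart F 0 0 -> exists a b c, quadpart F a b c.
Proof.
case=> h1 [h2 [-> h10 h20]].
have [g1 [g2 e1]] := mpoly2_split h1; have [g3 [g4 e2]] := mpoly2_split h2.
exists g1@_0, (g2 + g3)@_0, g4@_0, g1, (g2 + g3), g4; split=> //.
by rewrite e1 e2 h10 h20 mpolyC0; ring.
Qed.

Lemma linpart_vanishes F l m : linpart F l m -> vanishes_to 1 F.
Proof.
by case=> h1 [h2 [-> _ _]]; apply: vanishes_toD; apply: vanishes_toX.
Qed.

Lemma quadpart_vanishes F a b c : quadpart F a b c -> vanishes_to 2 F.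
Proof.
by case=> h1 [h2 [h3 [-> _ _ _]]]; do 2?apply: vanishes_toD;
  do 2!apply: vanishes_toX.
Qed.

Lemma linpart_coef F l m : linpart F l m -> F@_U_(0) = l /\ F@_U_(1) = m.
Proof.
case=> h1 [h2 [-> <- <-]]; rewrite !mcoeffD !mcoeffXiM !mnm1E /= add0r addr0.
by split; congr _@_(_); apply/mnmP=> i; rewrite mnmBE subnn mnm0E.
Qed.

Lemma quadpart_coef F a b c : quadpart F a b c ->
  [/\ F@_(U_(0) + U_(0)) = a, F@_(U_(0) + U_(1)) = b & F@_(U_(1) + U_(1)) = c].
Proof.
case=> h1 [h2 [h3 [-> <- <- <-]]]; rewrite !mcoeffD !mcoeffXiM.
rewrite !(mnmDE, mnmBE, mnm1E) /= !(add0r, addr0).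
by split; congr _@_(_); apply/mnmP=> -[[|[|//]]?]; rewrite !(mnmDE, mnmBE, mnm1E, mnm0E).
Qed.

Definition is_smooth F := exists l m, linpart F l m /\ (l != 0 \/ m != 0).
Definition is_double F := exists a b c, quadpart F a b c /\ [\/ a != 0, b != 0 | c != 0].

Lemma smooth_at_translate f P : smooth_at f P <-> is_smooth (translate f P).
Proof.
rewrite /smooth_at /multiplicity_at /is_smooth; set F := translate f P.
split=> [[v [m m1 Fm]]|[l [m [o nz]]]].
  have F0 : F@_0 = 0 by apply: v; rewrite mdeg0.
  have [l [k o]] := vanishes1_linpart F0; exists l, k; split=> //.
  have [<- <-] := linpart_coef o.
  move/eqP/mdeg1P: m1 Fm => [[[|[|//]] ip] /eqP->].
    by rewrite (_ : Ordinal ip = 0); [left | apply: val_inj].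
  by rewrite (_ : Ordinal ip = 1); [right | apply: val_inj].
split; first exact: (linpart_vanishes o).
case: nz => nz; [exists U_(0%R)%MM | exists U_(1%R)%MM]; rewrite ?mdeg1 //.
  by have [-> _] := linpart_coef o.
by have [_ ->] := linpart_coef o.
Qed.

Lemma double_point_translate f P : double_point f P <-> is_double (translate f P).
Proof.
rewrite /double_point /multiplicity_at /is_double; set F := translate f P.
split=> [[v [m m1 Fm]]|[a [b [c [o nz]]]]].
  have F0 : F@_0 = 0 by apply: v; rewrite mdeg0.
  have [l [k o]] := vanishes1_linpart F0.
  have [Fl Fk] := linpart_coef o; have := o.
  rewrite -Fl -Fk !v ?mdeg1 // => /linpart_quadpart[a [b [c o2]]].
  exists a, b, c; split=> //; apply: NNPP => nz.
  have [a0 b0 c0] : [/\ a = 0, b = 0 & c = 0].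
    by split; apply/eqP/negPn/negP => ?; apply: nz; constructor.
  case: o2 => h1 [h2 [h3 [eF h10 h20 h30]]].
  have v3 : vanishes_to 3 F.
    rewrite eF; do 2?apply: vanishes_toD; do 2!apply: vanishes_toX;
    by apply: vanishes_to1; congruence.
  by move: Fm; rewrite v3 ?m1 // eqxx.
split; first exact: (quadpart_vanishes o).
have [ea eb ec] := quadpart_coef o.
case: nz => nz;
  [exists (U_(0%R) + U_(0%R))%MM | exists (U_(0%R) + U_(1%R))%MM
  | exists (U_(1%R) + U_(1%R))%MM];
  by rewrite ?mdegD ?mdeg1 ?ea ?eb ?ec.
Qed.

Lemma smooth_not_singular f P n : (1 < n)%N -> smooth_at f P -> ~ multiplicity_at f P n.
Proof.
by move=> n2 [_ [m m1 nz]] [v _]; move: nz; rewrite v ?m1 // eqxx.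
Qed.

Lemma linpart_swap F l m : linpart F l m -> linpart (swap F) m l.
Proof.
case=> h1 [h2 [-> <- <-]]; exists (swap h2), (swap h1); split; rewrite ?mcoeff0_swap //.
by rewrite /swap !evE addrC.
Qed.

Lemma quadpart_swap F a b c : quadpart F a b c -> quadpart (swap F) c b a.
Proof.
case=> h1 [h2 [h3 [-> <- <- <-]]]; exists (swap h3), (swap h2), (swap h1).
by split; rewrite ?mcoeff0_swap // /swap !evE; ring.
Qed.

Lemma is_smooth_swap F : is_smooth F -> is_smooth (swap F).
Proof.
case=> l [m [o nz]]; exists m, l; split; first exact: linpart_swap.
by case: nz; [right | left].
Qed.

Lemma is_double_swap F : is_double F -> is_double (swap F).
Proof.
case=> a [b [c [o nz]]]; exists c, b, a; split; first exact: quadpart_swap.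
by case: nz; constructor.
Qed.

End Order.

(** * Contact with smooth arcs, and its behaviour under blow-up *)

Section Arcs.
Variable K : fieldType.
Implicit Types (f g h F G : {mpoly K[2]}) (t : K) (p q u v : {poly K}).

Lemma coprime_Xn n u : u.[0] != 0 -> coprimep 'X^n u.
Proof.
move=> u0; apply: coprimep_expl; rewrite coprimep_sym.
by rewrite -[X in coprimep _ X]subr0 -[0 in X in coprimep _ X]polyC0 coprimep_XsubC /root.
Qed.

Lemma dvdXn_mull n u v : u.[0] != 0 -> ('X^n %| u * v) = ('X^n %| v).
Proof. by move=> u0; apply: Gauss_dvdpr; exact: coprime_Xn. Qed.

Lemma dvdXn_mulXn m n u : ('X^(m + n) %| 'X^m * u) = ('X^n %| u).
Proof. by rewrite exprD dvdp_mul2l // expf_neq0 // polyX_eq0. Qed.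

Lemma dvdX_horner u : ('X %| u) = (u.[0] == 0).
Proof. by rewrite -[X in X %| _]subr0 -[0 in LHS]polyC0 dvdp_XsubCl. Qed.

Lemma dvdXnW m n u : (m <= n)%N -> 'X^n %| u -> 'X^m %| u.
Proof. by move=> mn; apply: dvdp_trans; exact: dvdp_exp2l. Qed.

Lemma dvdXn_coefP l q : reflect (forall i, (i < l)%N -> q`_i = 0) ('X^l %| q).
Proof.
apply: (iffP idP) => [/dvdpP[r ->] i il|q0]; first by rewrite coefMXn il.
rewrite -[q](poly_take_drop l) dvdp_addl ?dvdp_mull //.
rewrite (_ : take_poly l q = 0) ?dvdp0 //; apply/polyP => i.
by rewrite coef_take_poly coef0; case: ifP => // /q0.
Qed.

Lemma dvdXn_unit m n u : u.[0] != 0 -> 'X^m %| 'X^n * u -> (m <= n)%N.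
Proof.
move=> u0; apply: contraTT; rewrite -ltnNge => nm; apply: contra u0.
by move/(dvdXnW nm); rewrite -addn1 dvdXn_mulXn expr1 dvdX_horner.
Qed.

Lemma poly_X_unit u : u != 0 -> exists n v, u = 'X^n * v /\ v.[0] != 0.
Proof.
move=> u0; have [n [v]] := multiplicity_XsubC u 0.
by rewrite u0 /= => v0 ->; exists n, v; rewrite polyC0 subr0 mulrC.
Qed.

Lemma inverse_mod_Xn n u : u.[0] != 0 -> exists v, 'X^n %| u * v - 1.
Proof.
move=> u0; have /Bezout_eq1_coprimepP[[v w] /= e] : coprimep u 'X^n.
  by rewrite coprimep_sym coprime_Xn.
exists v; rewrite -e (_ : u * v - _ = - w * 'X^n) ?dvdp_mull //; ring.
Qed.

Lemma root0_mulX u : u.[0] = 0 -> exists v, u = 'X * v.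
Proof.
by move/eqP; rewrite -dvdX_horner => /dvdpP[v ->]; exists v; rewrite mulrC.
Qed.

Lemma hornerX0 u : ('X * u).[0] = 0.
Proof. by rewrite hornerM hornerX mul0r. Qed.

Lemma ev_X0 p q h : (ev ('X * p) ('X * q) h).[0] = h@_0.
Proof. by apply: ev_const0; apply: hornerX0. Qed.

(** Newton iteration for G(x, p(x)) = 0: a new term d x^(n+1) changes the value by
m d x^(n+1) up to higher order, so d can be chosen to cancel the next coefficient. *)
Lemma hensel G l m : linpart G l m -> m != 0 ->
  forall n, exists p, 'X^n %| ev 'X ('X * p) G.
Proof.
case=> h1 [h2 [eG _ h2m]] m0; elim=> [|n [p IH]].
  by exists 0; rewrite expr0 dvd1p.
case: n IH => [|n] IH.
  exists 0; rewrite expr1 dvdX_horner -{1}['X]mulr1 ev_X0 eG.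
  by rewrite !mcoeffD !mcoeff0XiM addr0.
have /dvdpP[r er] := IH.
(* r(0) is the next coefficient of the error. *)
pose d := - r.[0] / m; exists (p + d%:P * 'X^n).
set b' := 'X * (p + _); set b := 'X * p in er.
have eb : b' - b = d%:P * 'X^(n.+1) by rewrite /b' /b exprS; ring.
have [s1 e1] := ev_taylor 'X b' b h1; have [s2 e2] := ev_taylor 'X b' b h2.
have e : ev 'X b' G = 'X^(n.+1) * (r + d%:P * (ev 'X b' h2 + 'X * (s1 + p * s2))).
  transitivity (ev 'X b' G - ev 'X b G + r * 'X^(n.+1)); first by rewrite er subrK.
  rewrite eG !evE.
  rewrite (_ : _ - _ = 'X * (ev 'X b' h1 - ev 'X b h1) +
     b * (ev 'X b' h2 - ev 'X b h2) + (b' - b) * ev 'X b' h2); last by ring.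
  by rewrite e1 e2 eb /b; ring.
rewrite e -addn1 dvdXn_mulXn expr1 dvdX_horner !(hornerD, hornerM, hornerX, hornerC).
have -> : (ev 'X b' h2).[0] = m by rewrite /b' -{1}['X]mulr1 ev_X0.
by rewrite mul0r addr0 /d mulfVK // subrr.
Qed.

(** The arc is (T p(T), T q(T)): it passes through the origin with velocity
(p(0), q(0)), and is smooth when this is nonzero. *)
Definition has_arc F l := exists p q,
  (p.[0] != 0 \/ q.[0] != 0) /\ 'X^l %| ev ('X * p) ('X * q) F.

(** Transversal to the axis x = 0, which is the exceptional line in the charts used. *)
Definition has_transversal_arc F l := exists p q,
  p.[0] != 0 /\ 'X^l %| ev ('X * p) ('X * q) F.

(** The first coordinate of a transversal arc is a local parameter: reparametrize by
a compositional inverse of it, found modulo a power of T by applying [hensel] to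
y p(y) - x. *)
Lemma graph_of_transversal F l : has_transversal_arc F l ->
  exists p, 'X^l %| ev 'X ('X * p) F.
Proof.
case=> p [q [p0 d]].
pose G : {mpoly K[2]} := 'X_1 * peval 'X_1 p - 'X_0.
have oG : linpart G (-1) p.[0].
  exists (-1), (peval 'X_1 p); split; first by rewrite /G; ring.
    by rewrite mcoeffN mcoeff1 eqxx.
  exact: mcoeff0_peval.
have [s ds] := hensel oG p0 l.
have eG : ev 'X ('X * s) G = ('X * p) \Po ('X * s) - 'X.
  by rewrite /G !evE (peval_morph (ev _ _)) /= evX1 peval_comp comp_polyM comp_polyX.
exists (s * (q \Po ('X * s))).
have [r er] := ev_taylorl 'X (('X * p) \Po ('X * s)) ('X * (s * (q \Po ('X * s)))) F.
rewrite -(dvdp_addl _ (_ : _ %| ev (('X * p) \Po ('X * s)) ('X * (s * (q \Po ('X * s)))) F -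
  ev 'X ('X * (s * (q \Po ('X * s)))) F)); last first.
  by rewrite -opprB dvdpNr er -opprB -eG mulNr dvdpNr dvdp_mulr.
have -> : 'X * (s * (q \Po ('X * s))) = ('X * q) \Po ('X * s).
  by rewrite comp_polyM comp_polyX mulrA.
rewrite addrC subrK -ev_comp.
case/dvdpP: d => w ->; rewrite comp_polyM (rmorphXn (comp_poly _)) /= comp_polyX exprMn mulrCA.
exact: dvdp_mulr.
Qed.

Lemma has_arcW F k l : (k <= l)%N -> has_arc F l -> has_arc F k.
Proof.
by move=> kl [p [q [nz d]]]; exists p, q; split=> //; apply: dvdXnW kl d.
Qed.

Lemma transversal_has_arc F l : has_transversal_arc F l -> has_arc F l.
Proof. by case=> p [q [nz d]]; exists p, q; split=> //; left. Qed.

Lemma has_arc_swap F l : has_arc F l -> has_arc (swap F) l.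
Proof.
case=> p [q [nz d]]; exists q, p; rewrite ev_swap; split=> //.
by case: nz; [right | left].
Qed.

Lemma ev_linpart F l m p q : linpart F l m ->
  exists r, ev ('X * p) ('X * q) F = 'X * r /\ r.[0] = l * p.[0] + m * q.[0].
Proof.
case=> h1 [h2 [-> <- <-]].
exists (p * ev ('X * p) ('X * q) h1 + q * ev ('X * p) ('X * q) h2).
by rewrite !evE hornerD !hornerM !ev_X0; split; ring.
Qed.

Lemma ev_quadpart F a b c p q : quadpart F a b c ->
  exists r, ev ('X * p) ('X * q) F = 'X^2 * r /\
    r.[0] = a * p.[0] ^+ 2 + b * p.[0] * q.[0] + c * q.[0] ^+ 2.
Proof.
case=> h1 [h2 [h3 [-> <- <- <-]]]; set e := ev ('X * p) ('X * q).
exists (p ^+ 2 * e h1 + p * q * e h2 + q ^+ 2 * e h3).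
by rewrite /e !evE !hornerD !hornerM !ev_X0; split; ring.
Qed.

(** Contact at least 3 with a double point forces the velocity to be a tangent vector. *)
Lemma quadpart_tangent F a b c p q : quadpart F a b c -> 'X^3 %| ev ('X * p) ('X * q) F ->
  a * p.[0] ^+ 2 + b * p.[0] * q.[0] + c * q.[0] ^+ 2 = 0.
Proof.
move=> /(@ev_quadpart _ _ _ _ p q)[r [-> <-]].
by rewrite (@dvdXn_mulXn 2 1) expr1 dvdX_horner => /eqP.
Qed.

Lemma double_contact2 F p q : is_double F -> 'X^2 %| ev ('X * p) ('X * q) F.
Proof.
case=> a [b [c [/(@ev_quadpart _ _ _ _ p q)[r [-> _]] _]]].
exact: dvdp_mulr.
Qed.

(** G is the strict transform of F in the chart (u, v) |-> (u, u v) at its point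
(0, t), translated to the origin. *)
Definition blowup_rel F t G :=
  ev 'X_0 ('X_0 * (t%:MP + 'X_1)) F = 'X_0 ^+ 2 * G.

Lemma mpolyX_neq0 (i : 'I_2) : 'X_i != 0 :> {mpoly K[2]}.
Proof.
by apply/eqP => /(congr1 (mcoeff U_(i))) /eqP; rewrite mcoeffX eqxx mcoeff0 oner_eq0.
Qed.

Lemma blowup_rel_ev (A : comAlgType K) (a b : A) F t G : blowup_rel F t G ->
  ev a (a * (t%:A + b)) F = a ^+ 2 * ev a b G.
Proof. by move/(congr1 (ev a b)); rewrite ev_ev !evE. Qed.

(** The restriction of the strict transform to the exceptional line is the quadratic
form of F at the direction (1, t + y). *)
Lemma blowup_form F t G a b c : quadpart F a b c -> blowup_rel F t G ->
  exists S, G = (a + b * t + c * t ^+ 2)%:MP +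
     'X_0 * S + 'X_1 * ((b + 2 * c * t)%:MP + 'X_1 * c%:MP).
Proof.
case=> h1 [h2 [h3 [-> <- <- <-]]] rel.
have [g1 [k1 e1]] := mpoly2_split h1; have [g2 [k2 e2]] := mpoly2_split h2.
have [g3 [k3 e3]] := mpoly2_split h3.
pose e := ev 'X_0 ('X_0 * (t%:MP + 'X_1) : {mpoly K[2]}).
have eh h g k : h = (h@_0)%:MP + 'X_0 * g + 'X_1 * k ->
    e h = (h@_0)%:MP + 'X_0 * (e g + (t%:MP + 'X_1) * e k).
  by move=> ->; rewrite /e !evE alg_mpolyC !mcoeffD !mcoeff0XiM mcoeffC eqxx /= mulr1 !addr0; ring.
pose s g k := e g + (t%:MP + 'X_1) * e k.
exists (s g1 k1 + (t%:MP + 'X_1) * s g2 k2 + (t%:MP + 'X_1) ^+ 2 * s g3 k3).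
have X2 : ('X_0 : {mpoly K[2]}) ^+ 2 != 0 by rewrite expf_neq0 ?mpolyX_neq0.
apply: (mulfI X2); rewrite -rel !evE -!/e (eh _ _ _ e1) (eh _ _ _ e2) (eh _ _ _ e3) -!/(s _ _).
rewrite !mpolyCD !mpolyCM.
rewrite (_ : (2 : K)%:MP = 2) ?mpolyC_nat //.
move: (s g1 k1) (s g2 k2) (s g3 k3) (h1@_0)%:MP (h2@_0)%:MP (h3@_0)%:MP.
by move=> s1 s2 s3 c1 c2 c3; ring.
Qed.

Lemma blowup_value F t G a b c : quadpart F a b c -> blowup_rel F t G ->
  G@_0 = a + b * t + c * t ^+ 2.
Proof.
move=> o /(blowup_form o)[S ->].
by rewrite !mcoeffD !mcoeff0XiM mcoeffC eqxx mulr1 !addr0.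
Qed.

Lemma blowup_linpart F t G a b c : quadpart F a b c -> blowup_rel F t G ->
  a + b * t + c * t ^+ 2 = 0 -> exists l, linpart G l (b + 2 * c * t).
Proof.
move=> o /(blowup_form o)[S ->] ->; exists S@_0, S, ((b + 2 * c * t)%:MP + 'X_1 * c%:MP).
rewrite mpolyC0 add0r mcoeffD mcoeffC eqxx mulr1 mcoeff0XiM addr0.
by [].
Qed.

(** At a double root, G is c y^2 modulo x: either it is smooth and tangent
to the exceptional line, or it is singular and its quadratic part has coefficient c
at y^2. *)
Lemma blowup_quadpart F t G a b c : quadpart F a b c -> blowup_rel F t G ->
  a + b * t + c * t ^+ 2 = 0 -> b + 2 * c * t = 0 ->
  (exists l, l != 0 /\ linpart G l 0) \/ (exists a' b', quadpart G a' b' c).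
Proof.
move=> o rel r1 r2; have [S eG] := blowup_form o rel.
rewrite r1 r2 !mpolyC0 !add0r in eG.
have [S0|S0] := eqVneq (S@_0) 0; [right|left].
  have [g [h e]] := mpoly2_split S; rewrite S0 mpolyC0 add0r in e.
  exists g@_0, h@_0, g, h, c%:MP.
  by rewrite mcoeffC eqxx mulr1; split=> //; rewrite eG e; ring.
exists S@_0; split=> //; exists S, ('X_1 * c%:MP).
by rewrite mcoeff0XiM eG.
Qed.

(** The image of the arc (x, y) is (x, x (t + y)), and the factor x^2 in front of G
accounts for the two extra orders of contact. *)
Lemma push_arc F t G p q l : blowup_rel F t G ->
  'X^l %| ev ('X * p) ('X * q) G ->
  'X^(l.+2) %| ev ('X * p) ('X * (p * (t%:P + 'X * q))) F.
Proof.
move=> rel d; rewrite mulrA -[t%:P]alg_polyC (blowup_rel_ev _ _ rel).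
by rewrite exprMn -mulrA (@dvdXn_mulXn 2 l) dvdp_mull.
Qed.

Lemma push_transversal_arc F t G l : blowup_rel F t G ->
  has_transversal_arc G l -> has_transversal_arc F l.+2.
Proof.
move=> rel [p [q [p0 d]]]; exists p, (p * (t%:P + 'X * q)).
by split=> //; apply: push_arc d.
Qed.

(** The lift has second coordinate q / p - t; it is a polynomial only modulo a power
of T, which is enough to preserve the contact. *)
Lemma lift_arc F t G p q l : blowup_rel F t G -> p.[0] != 0 -> q.[0] = t * p.[0] ->
  'X^(l.+2) %| ev ('X * p) ('X * q) F -> has_transversal_arc G l.
Proof.
move=> rel p0 q0 d; have [s ds] := inverse_mod_Xn l.+2 p0.
have ps0 : p.[0] * s.[0] = 1.
  apply/eqP; rewrite -subr_eq0 -hornerM -[1](hornerC _ 0) -hornerN -hornerD polyC1.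
  by rewrite -dvdX_horner -['X]expr1; apply: dvdXnW ds.
have [|v ev1] := @root0_mulX (q * s - t%:P).
  by rewrite !(hornerE, q0) -mulrA ps0; ring.
exists p, v; split=> //.
have [r er] := ev_taylor ('X * p) ('X * q) (('X * p) * (t%:P + 'X * v)) F.
have : 'X^(l.+2) %| ev ('X * p) (('X * p) * (t%:P + 'X * v)) F.
  rewrite -(dvdp_addr _ (_ : _ %| ev ('X * p) ('X * q) F -
     ev ('X * p) (('X * p) * (t%:P + 'X * v)) F)) ?subrK // er.
  rewrite -ev1 (_ : _ * r = (p * s - 1) * (- 'X * q * r)); last by ring.
  exact: dvdp_mulr.
rewrite -[t%:P]alg_polyC (blowup_rel_ev _ _ rel) exprMn -mulrA (@dvdXn_mulXn 2 l).
by rewrite dvdXn_mull // horner_exp expf_neq0.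
Qed.

Lemma smooth_transversal_contact G l p q : linpart G l 0 -> l != 0 -> p.[0] != 0 ->
  ~~ ('X^2 %| ev ('X * p) ('X * q) G).
Proof.
move=> /(@ev_linpart _ _ _ p q)[r [-> r0]] l0 p0.
rewrite (@dvdXn_mulXn 1 1) expr1 dvdX_horner r0 mul0r addr0.
by rewrite mulf_eq0 negb_or l0.
Qed.

(** An arc along the exceptional line has velocity (0, 1), where the quadratic form of
G takes the value c; by [quadpart_tangent] its contact with G is at most 2. *)
Lemma double_arc_transversal G a b c p q l : quadpart G a b c -> c != 0 ->
  (p.[0] != 0 \/ q.[0] != 0) -> 'X^(l.+3) %| ev ('X * p) ('X * q) G -> p.[0] != 0.
Proof.
move=> o c0 nz d; apply: contraPN nz => /eqP p0.
have /(quadpart_tangent o) : 'X^3 %| ev ('X * p) ('X * q) G by apply: dvdXnW d.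
rewrite p0 expr0n /= !mulr0 !mul0r !add0r => /eqP; rewrite mulf_eq0 (negPf c0) /=.
by rewrite expf_eq0 /= => /eqP->; rewrite eqxx; case.
Qed.

Lemma quadpart_is_double G a b c : quadpart G a b c -> c != 0 -> is_double G.
Proof. by move=> o c0; exists a, b, c; split=> //; constructor 3. Qed.

(** For l <= 2 any arc will do, and the axis y = 0 is transversal. *)
Lemma double_has_transversal G a b c l : quadpart G a b c -> c != 0 ->
  has_arc G l -> has_transversal_arc G l.
Proof.
move=> o c0; case: (ltnP l 3) => l3 [p [q [nz d]]].
  exists 1, 0; rewrite hornerC oner_eq0; split=> //.
  apply: dvdXnW (double_contact2 _ _ (quadpart_is_double o c0)); exact: l3.
exists p, q; split=> //; case: l l3 d => [|[|[|l]]] // _ d.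
exact: double_arc_transversal o c0 nz d.
Qed.

Lemma lift_arc_tangent F t G c l : quadpart F (c * t ^+ 2) (- (2 * c * t)) c -> c != 0 ->
  blowup_rel F t G -> (0 < l)%N -> has_arc F l.+2 -> has_transversal_arc G l.
Proof.
move=> o c0 rel l0 [p [q [nz d]]].
have /(quadpart_tangent o) : 'X^3 %| ev ('X * p) ('X * q) F by apply: dvdXnW d.
rewrite (_ : _ + _ = c * (q.[0] - t * p.[0]) ^+ 2); last by ring.
move/eqP; rewrite mulf_eq0 (negPf c0) expf_eq0 /= subr_eq0 => /eqP q0.
apply: (lift_arc rel _ q0 d).
by case: nz => //; apply: contra_neq => p0; rewrite q0 p0 mulr0.
Qed.

(** Measures how close F is to being singular all along a smooth arc. The shift between
the two orders is the one that a double point has on every arc, and blowing down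
keeps it. *)
Definition has_singular_arc F m := exists p q,
  [/\ p.[0] != 0 \/ q.[0] != 0, 'X^(m.+1) %| ev ('X * p) ('X * q) F,
      'X^m %| ev ('X * p) ('X * q) F^`M(0) & 'X^m %| ev ('X * p) ('X * q) F^`M(1)].

Lemma double_singular_contact1 F p q : is_double F ->
  [/\ 'X^2 %| ev ('X * p) ('X * q) F,
      'X^1 %| ev ('X * p) ('X * q) F^`M(0) & 'X^1 %| ev ('X * p) ('X * q) F^`M(1)].
Proof.
move=> dF; split; first exact: double_contact2.
all: case: dF => a [b [c [[h1 [h2 [h3 [-> _ _ _]]]] _]]].
all: rewrite expr1 dvdX_horner ev_X0 !mderivD !mderivM !mderivXi /=.
all: rewrite !mulr0n !mulr1n !mcoeffD; do ?rewrite mul0r; do ?rewrite mul1r.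
all: by rewrite !(mcoeff0XiM, mcoeffD, mcoeff0) !addr0.
Qed.

Lemma has_singular_arc_swap F m : has_singular_arc F m -> has_singular_arc (swap F) m.
Proof.
case=> p [q [nz d d0 d1]]; exists q, p; rewrite ev_swap; split=> //.
- by case: nz; [right | left].
- by rewrite /swap mderiv_ev !mderivXi /= mulr0 mulr1 add0r ev_ev !evE.
- by rewrite /swap mderiv_ev !mderivXi /= mulr0 mulr1 addr0 ev_ev !evE.
Qed.

(** By the chain rule F_y becomes x G_y and F_x becomes 2 x G + x^2 G_x - (t + y) x G_y,
so that one order is gained along the image of a transversal arc. For m = 1
the given arc of G need not be transversal, but the axis y = 0 can be used. *)
Lemma push_singular_arc F t G a b c m : blowup_rel F t G -> quadpart G a b c -> c != 0 ->
  (0 < m)%N -> has_singular_arc G m -> has_singular_arc F m.+1.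
Proof.
move=> rel o c0 m0 sG.
have [p [q [p0 d d0 d1]]] : exists p q, [/\ p.[0] != 0,
   'X^(m.+1) %| ev ('X * p) ('X * q) G, 'X^m %| ev ('X * p) ('X * q) G^`M(0) &
   'X^m %| ev ('X * p) ('X * q) G^`M(1)].
  case: m m0 sG => [|[|m]] // _.
    have [] := double_singular_contact1 1 0 (quadpart_is_double o c0).
    by exists 1, 0; rewrite hornerC oner_eq0; split.
  case=> p [q [nz d d0 d1]]; exists p, q; split=> //.
  exact: double_arc_transversal o c0 nz d.
exists p, (p * (t%:P + 'X * q)).
pose e := ev ('X_0 : {mpoly K[2]}) ('X_0 * (t%:MP + 'X_1)).
have e1 : e F^`M(1) = 'X_0 * G^`M(1).
  move: (congr1 (mderiv 1) rel); rewrite mderiv_ev !(mderivM, mderivD, mderivC, mderivXi, expr2) /=.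
  rewrite -!/(e _) => E; apply: (mulfI (mpolyX_neq0 0)); rewrite mulrA -[RHS]addr0.
  transitivity (e F^`M(0) * 0 + e F^`M(1) * (0 * (t%:MP + 'X_1) + 'X_0 * (0 + 1))); first by ring.
  by rewrite E; ring.
have e0 : e F^`M(0) = 2 * 'X_0 * G + 'X_0 ^+ 2 * G^`M(0) - (t%:MP + 'X_1) * ('X_0 * G^`M(1)).
  move: (congr1 (mderiv 0) rel); rewrite mderiv_ev !(mderivM, mderivD, mderivC, mderivXi, expr2) /=.
  rewrite -!/(e _) -e1 => E.
  transitivity (e F^`M(0) * 1 + e F^`M(1) * (1 * (t%:MP + 'X_1) + 'X_0 * (0 + 0)) -
     (t%:MP + 'X_1) * e F^`M(1)); first by ring.
  by rewrite E; ring.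
have ee h : ev ('X * p) ('X * (p * (t%:P + 'X * q))) h = ev ('X * p) ('X * q) (e h).
  by rewrite /e ev_ev !evE alg_polyC mulrA.
split; first by left.
- by apply: (dvdXnW _ (push_arc rel d)).
- rewrite ee e0 !evE -!mulrA exprS; apply: dvdp_sub; last first.
    by rewrite mulrCA dvdp_mul2l ?polyX_eq0 //; do 2!apply: dvdp_mull.
  apply: dvdp_add; last first.
    by rewrite dvdp_mul2l ?polyX_eq0 //; do 3!apply: dvdp_mull.
  rewrite mulrCA dvdp_mul2l ?polyX_eq0 //; do 2!apply: dvdp_mull.
  by apply: dvdXnW d.
- by rewrite ee e1 !evE exprS -mulrA dvdp_mul2l ?polyX_eq0 // dvdp_mull.
Qed.

End Arcs.

(** * Curvilinear schemes and smooth arcs *)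

Section Schemes.
Variable K : fieldType.
Implicit Types (f g h F G : {mpoly K[2]}) (I J : {mpoly K[2]} -> Prop).
Implicit Types (P Q : 2.-tuple K).

Lemma ideal_sub I g h : is_ideal I -> I g -> I h -> I (g - h).
Proof. by case=> _ ID IM Ig Ih; apply: ID => //; rewrite -mulN1r; apply: IM. Qed.

Lemma ideal_mulr I g h : is_ideal I -> I g -> I (g * h).
Proof. by case=> _ _ IM Ig; rewrite mulrC; apply: IM. Qed.

Lemma ideal_scale I (c : K) g : is_ideal I -> I g -> I (c *: g).
Proof. by case=> _ _ IM Ig; rewrite -mul_mpolyC; apply: IM. Qed.

Lemma ideal_sum I (T : finType) (F : T -> {mpoly K[2]}) :
  is_ideal I -> (forall i, I (F i)) -> I (\sum_i F i).
Proof. by case=> I0 ID _ IF; elim/big_ind: _. Qed.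

Lemma row_kernel l k (M : 'M[K]_(l, k)) : (k < l)%N ->
  exists2 c : 'rV_l, c != 0 & c *m M = 0.
Proof.
move=> kl; exists (nz_row (kermx M)).
  rewrite nz_row_eq0 -mxrank_eq0 mxrank_ker subn_eq0 -ltnNge.
  exact: leq_ltn_trans (rank_leq_col M) kl.
by apply/sub_kermxP; exact: nz_row_sub.
Qed.

Lemma combination_in_ideal I (k l : nat) (s : 'I_k -> {mpoly K[2]})
    (b : 'I_l -> {mpoly K[2]}) : is_ideal I -> (k < l)%N ->
  (forall i, exists c : 'rV[K]_k, I (b i - \sum_(j < k) c 0 j *: s j)) ->
  exists2 c : 'rV[K]_l, c != 0 & I (\sum_(i < l) c 0 i *: b i).
Proof.
move=> iI kl /fin_all_exists[r Ir].
have [c c0 cM] := row_kernel (\matrix_(i, j) r i 0 j) kl; exists c => //.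
have := @ideal_sum I _ (fun i => c 0 i *: (b i - \sum_j r i 0 j *: s j)) iI
  (fun i => ideal_scale _ iI (Ir i)).
congr I; under eq_bigr do rewrite scalerBr scaler_sumr.
rewrite sumrB exchange_big /= [X in _ - X]big1 ?subr0 // => j _.
transitivity ((c *m \matrix_(i, j) r i 0 j) 0 j *: s j).
  rewrite mxE scaler_suml; apply: eq_bigr => i _.
  by rewrite mxE scalerA.
by rewrite cM mxE scale0r.
Qed.

(** A scheme of length l has no spanning family of fewer than l functions. *)
Lemma length_le_span I l k (s : 'I_k -> {mpoly K[2]}) :
  is_ideal I -> has_length I l ->
  (forall h, exists c : 'rV[K]_k, I (h - \sum_(j < k) c 0 j *: s j)) -> (l <= k)%N.
Proof.
move=> iI [b bP] span; rewrite leqNgt; apply/negP => kl.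
have [c c0 Ic] := combination_in_ideal iI kl (fun i => span (b i)).
have [d [_ uniq_d]] := bP 0; have [I0 _ _] := iI.
move: c0; rewrite -(uniq_d c) ?(uniq_d 0) ?eqxx //.
- by rewrite big1 ?subr0 // => i _; rewrite mxE scale0r.
- exact: ideal_sub.
Qed.

Lemma peval_poly (w : {mpoly K[2]}) n (E : nat -> K) :
  peval w (\poly_(i < n) E i) = \sum_(i < n) E i *: w ^+ i.
Proof.
rewrite poly_def rmorph_sum /=; apply: eq_bigr => i _.
by rewrite linearZ rmorphXn /= pevalX.
Qed.

(** The powers of w up to the l-th are linearly dependent modulo I. *)
Lemma univariate_in_ideal I l (w : {mpoly K[2]}) : is_ideal I -> has_length I l ->
  exists2 q : {poly K}, q != 0 & I (peval w q).
Proof.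
move=> iI [b bP].
have [i|c c0 Ic] := @combination_in_ideal I l l.+1 b (fun i => w ^+ i) iI (ltnSn l).
  by have [c [Ic _]] := bP (w ^+ i); exists c.
exists (\poly_(i < l.+1) c 0 (inord i)).
  apply: contraNneq c0 => q0; apply/eqP/rowP => i; rewrite mxE.
  by have := congr1 (fun q : {poly K} => q`_i) q0; rewrite coef_poly ltn_ord inord_val coef0.
move: Ic; congr I; rewrite peval_poly; apply: eq_bigr => i _.
by rewrite inord_val.
Qed.

(** Translations and [swap] carry curvilinear schemes to curvilinear schemes; tau is
the map of the plane that phi is the pullback along. *)
Section Transport.
Variables (phi psi : {lrmorphism {mpoly K[2]} -> {mpoly K[2]}}).
Variable (tau : 2.-tuple K -> 2.-tuple K).
Hypotheses (phiK : cancel phi psi) (psiK : cancel psi phi).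
Hypothesis phi_tau : forall g Q, (phi g).@[tnth Q] = g.@[tnth (tau Q)].
Variables (P P' : 2.-tuple K).
Hypothesis tauP : forall Q, tau Q = P <-> Q = P'.

Lemma transport_scheme I l : is_ideal I -> supported_at I P -> has_length I l ->
  [/\ is_ideal (I \o psi), supported_at (I \o psi) P' & has_length (I \o psi) l].
Proof.
move=> [I0 ID IM] sup [b bP]; split.
- split=> /= [|g h Ig Ih|g h Ih]; first by rewrite rmorph0.
    by rewrite rmorphD; apply: ID.
  by rewrite rmorphM; apply: IM.
- move=> Q; rewrite -tauP -sup; split=> van g /= Ig.
    by rewrite -phi_tau; apply: van; rewrite /= phiK.
  by rewrite -[g]psiK phi_tau; apply: van.
- exists (phi \o b) => g; have [c [Ic uc]] := bP (psi g).
  have e d : psi (g - \sum_(i < l) d 0 i *: phi (b i)) =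
      psi g - \sum_(i < l) d 0 i *: b i.
    rewrite rmorphB rmorph_sum /=; congr (_ - _); apply: eq_bigr => i _.
    by rewrite linearZ /= phiK.
  exists c; split=> [|d]; rewrite /= e //; exact: uc.
Qed.

Lemma transport_contains f l : (forall g, smooth_at g P -> smooth_at (phi g) P') ->
  contains_curvilinear f P l -> contains_curvilinear (phi f) P' l.
Proof.
move=> smo [I [iI sup len [g sg Ig]] If].
have [iI' sup' len'] := transport_scheme iI sup len.
exists (I \o psi); last by rewrite /= phiK.
by split=> //; exists (phi g); [exact: smo | rewrite /= phiK].
Qed.

End Transport.

Definition orig : 2.-tuple K := [tuple 0; 0].

Lemma translateE f P :
  translate f P = ev ((tnth P 0)%:MP + 'X_0) ((tnth P 1)%:MP + 'X_1) f.
Proof.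
rewrite -comp_mpoly_ev /translate; congr comp_mpoly; apply: eq_from_tnth => i.
rewrite tnth_mktuple; case: i => [[|[|//]] ip].
  by rewrite (_ : Ordinal ip = 0) //; apply: val_inj.
by rewrite (_ : Ordinal ip = 1) //; apply: val_inj.
Qed.

Lemma tuple2_eqP P Q : P = Q <-> tnth P 0 = tnth Q 0 /\ tnth P 1 = tnth Q 1.
Proof.
split=> [->//|[e0 e1]]; apply: eq_from_tnth => -[[|[|//]] ip].
  by rewrite (_ : Ordinal ip = 0) //; apply: val_inj.
by rewrite (_ : Ordinal ip = 1) //; apply: val_inj.
Qed.

(** [translate] as an algebra morphism. *)
Definition shift P : {mpoly K[2]} -> {mpoly K[2]} :=
  ev ((tnth P 0)%:MP + 'X_0) ((tnth P 1)%:MP + 'X_1).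

Definition opp_pt P : 2.-tuple K := [tuple - tnth P 0; - tnth P 1].

Lemma translate_opp P f : translate (translate f P) (opp_pt P) = f.
Proof.
rewrite !translateE ev_ev !evE !alg_mpolyC.
rewrite [tnth (opp_pt P) 0]/(- tnth P 0) [tnth (opp_pt P) 1]/(- tnth P 1) !mpolyCN.
by rewrite !addrA !subrr !add0r ev_id.
Qed.

Lemma opp_ptK P : opp_pt (opp_pt P) = P.
Proof. by apply/tuple2_eqP; rewrite !(tnth_nth 0) /= !opprK !(tnth_nth 0). Qed.

Lemma translate_orig f : translate f orig = f.
Proof. by rewrite translateE !(tnth_nth 0) /= mpolyC0 !add0r ev_id. Qed.

Lemma meval_translate f P Q : (translate f P).@[tnth Q] =
  f.@[tnth [tuple tnth P 0 + tnth Q 0; tnth P 1 + tnth Q 1]].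
Proof.
rewrite !meval_ev translateE ev_ev !evE !alg_polyC /= !(tnth_nth 0) /=.
by rewrite !polyCD.
Qed.

Lemma meval_orig g : g.@[tnth orig] = g@_0.
Proof. by rewrite meval_ev !(tnth_nth 0) /= ev_const0 // hornerC. Qed.

Lemma meval_swap Q g : (swap g).@[tnth Q] = g.@[tnth [tuple tnth Q 1; tnth Q 0]].
Proof. by rewrite !meval_ev ev_swap !(tnth_nth 0). Qed.

Lemma smooth_at_orig g : smooth_at g orig <-> is_smooth g.
Proof. by rewrite smooth_at_translate translate_orig. Qed.

Lemma shiftE P f : shift P f = translate f P.
Proof. by rewrite translateE. Qed.

Lemma shiftK P : cancel (shift P) (shift (opp_pt P)).
Proof. by move=> g; rewrite !shiftE translate_opp. Qed.

Lemma shift_oppK P : cancel (shift (opp_pt P)) (shift P).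
Proof. by move=> g; rewrite -{1}[P]opp_ptK shiftK. Qed.

Lemma contains_translate f P l :
  contains_curvilinear f P l <-> contains_curvilinear (translate f P) orig l.
Proof.
have addx (x y : K) : x + y = x <-> y = 0.
  by split=> [|->]; rewrite ?addr0 // -{2}[x]addr0 => /addrI.
have addNx (x y : K) : - x + y = 0 <-> y = x.
  by rewrite addrC; split=> [/subr0_eq|->] //; rewrite subrr.
split=> cf.
  rewrite -shiftE.
  apply: (@transport_contains (ev _ _) (ev _ _) (fun Q =>
    [tuple tnth P 0 + tnth Q 0; tnth P 1 + tnth Q 1]) (@shiftK P) (@shift_oppK P)) cf.
  - by move=> g Q; rewrite -meval_translate translateE.
  - by move=> Q; rewrite !tuple2_eqP !(tnth_nth 0) /= !addx.
  - by move=> g; rewrite smooth_at_orig smooth_at_translate translateE.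
rewrite -[f](@shiftK P) [shift P f]shiftE.
apply: (@transport_contains (ev _ _) (ev _ _) (fun Q =>
  [tuple tnth (opp_pt P) 0 + tnth Q 0; tnth (opp_pt P) 1 + tnth Q 1])
   (@shift_oppK P) (@shiftK P)) cf.
- by move=> g Q; rewrite -meval_translate translateE.
- move=> Q; rewrite !tuple2_eqP.
  change ((- tnth P 0 + tnth Q 0 = 0 /\ - tnth P 1 + tnth Q 1 = 0) <->
    (tnth Q 0 = tnth P 0 /\ tnth Q 1 = tnth P 1)).
  by rewrite !addNx.
- move=> g; rewrite smooth_at_orig smooth_at_translate.
  by rewrite (_ : translate _ P = g) // -shiftE; exact: shift_oppK.
Qed.

Lemma swap_pt Q : [tuple tnth Q 1; tnth Q 0] = orig <-> Q = orig.
Proof. by rewrite !tuple2_eqP !(tnth_nth 0) /=; split=> -[-> ->]. Qed.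

Lemma contains_swap F l :
  contains_curvilinear F orig l -> contains_curvilinear (swap F) orig l.
Proof.
apply: (@transport_contains (ev _ _) (ev _ _) _ (@swapK _) (@swapK _) _ _ _ swap_pt).
  exact: (fun g Q => meval_swap Q g).
by move=> g; rewrite !smooth_at_orig; apply: is_smooth_swap.
Qed.

(** The scheme is defined by the kernel of K[x, y] -> K[T]/(T^l) along the graph; the
powers of x up to x^(l-1) are a basis of its functions. *)
Lemma graph_contains F l p : (0 < l)%N -> 'X^l %| ev 'X ('X * p) F ->
  contains_curvilinear F orig l.
Proof.
move=> l0 dF; exists (fun h => 'X^l %| ev 'X ('X * p) h) => //; split.
- split=> [|g h dg dh|g h dh]; first by rewrite ev0 dvdp0.
    by rewrite evD dvdp_add.
  by rewrite evM dvdp_mull.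
- move=> Q; split=> [van|-> g dg]; last first.
    apply/eqP; rewrite meval_orig -(ev_X0 1 p) mulr1 -dvdX_horner -['X]expr1.
    exact: dvdXnW dg.
  have := van ('X_0 ^+ l); rewrite evXn evX0 => /(_ (dvdpp _)).
  rewrite rmorphXn /= mevalXU => /eqP; rewrite expf_eq0 l0 /= => /eqP Q0.
  have := van ('X_1 - 'X_0 * peval 'X_0 p).
  rewrite !evE (peval_morph (ev _ _)) /= evX0 peval_comp comp_polyXr subrr => /(_ (dvdp0 _)).
  rewrite mevalB mevalM !mevalXU Q0 mul0r subr0 => Q1.
  by apply/tuple2_eqP.
- exists (fun i => 'X_0 ^+ i) => g.
  have E c : ev 'X ('X * p) (g - \sum_(i < l) c 0 i *: 'X_0 ^+ i) =
      ev 'X ('X * p) g - \sum_(i < l) c 0 i *: 'X^i :> {poly K}.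
    rewrite evB (raddf_sum (ev _ _)) /=; congr (_ - _); apply: eq_bigr => i _.
    by rewrite linearZ /= evXn evX0.
  have coefS (c : 'rV[K]_l) (i : 'I_l) : (\sum_(i < l) c 0 i *: 'X^i)`_i = c 0 i.
    rewrite coef_sum (bigD1 i) //= coefZ coefXn eqxx mulr1 big1 ?addr0 // => j ji.
    by rewrite coefZ coefXn eq_sym (inj_eq val_inj) (negPf ji) mulr0.
  exists (\row_i (ev 'X ('X * p) g)`_i); split=> [|c]; rewrite E.
    apply/dvdXn_coefP => i il.
    by rewrite coefB (coefS _ (Ordinal il)) mxE subrr.
  move=> /dvdXn_coefP dc; apply/rowP => i; rewrite mxE; apply/eqP; rewrite -subr_eq0.
  by rewrite -(coefS c i) -coefB dc.
- exists ('X_1 - 'X_0 * peval 'X_0 p); last first.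
    by rewrite !evE (peval_morph (ev _ _)) /= evX0 peval_comp comp_polyXr subrr dvdp0.
  apply/smooth_at_orig; exists (- p.[0]), 1; split; last by right; rewrite oner_neq0.
  exists (- peval 'X_0 p), 1; split; first by ring.
    by rewrite mcoeffN mcoeff0_peval.
  by rewrite mcoeff1 eqxx.
Qed.

(** The weak Nullstellensatz below is proved directly for ideals that contain nonzero
polynomials in each single variable, which ideals of finite length do. *)
Definition no_zero J := forall v : 2.-tuple K, exists2 h, J h & h.@[tnth v] != 0.

Lemma colon_ideal J w : is_ideal J -> is_ideal (fun h => J (w * h)).
Proof.
case=> J0 JD JM; split=> [|g h Jg Jh|g h Jh]; first by rewrite mulr0.
  by rewrite mulrDr; apply: JD.
by rewrite mulrCA; apply: JM.
Qed.

Lemma no_zero_sub J J' : (forall h, J h -> J' h) -> no_zero J -> no_zero J'.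
Proof. by move=> JJ' nz v; have [h Jh hv] := nz v; exists h => //; apply: JJ'. Qed.

Lemma no_zero_point J (x y : K) : is_ideal J -> no_zero J ->
  J ('X_0 - x%:MP) -> J ('X_1 - y%:MP) -> J 1.
Proof.
move=> iJ nz Jx Jy; have [h Jh hv] := nz [tuple x; y].
have [h1 [h2 e]] := mpoly2_split (translate h [tuple x; y]).
(* Taylor expansion of h at the point (x, y). *)
have [h1' [h2' eh]] : exists g1 g2,
    h = (h.@[tnth [tuple x; y]])%:MP + ('X_0 - x%:MP) * g1 + ('X_1 - y%:MP) * g2.
  exists (shift (opp_pt [tuple x; y]) h1), (shift (opp_pt [tuple x; y]) h2).
  have -> : h.@[tnth [tuple x; y]] = (translate h [tuple x; y])@_0.
    rewrite -meval_orig meval_translate; congr _.@[tnth _].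
    by apply/tuple2_eqP; rewrite !(tnth_nth 0) /= !addr0.
  rewrite -{1}[h](@shiftK [tuple x; y]) (shiftE [tuple x; y] h) {1}e /shift !evE alg_mpolyC.
  by rewrite !(tnth_nth 0) /= !mpolyCN ![- _%:MP + _]addrC.
have Jc : J (h.@[tnth [tuple x; y]])%:MP.
  rewrite (_ : _%:MP = h - ('X_0 - x%:MP) * h1' - ('X_1 - y%:MP) * h2').
    by do 2!(apply: ideal_sub => //; last exact: ideal_mulr).
  by rewrite {2}eh; ring.
rewrite -mpolyC1 -(mulVf hv) mpolyCM.
by case: iJ => _ _; apply.
Qed.

(** The product of the other factors lies in the colon ideal of J by w - x, so by
induction 1 lies in it, and w - x itself lies in J. The hypothesis ranges over all
larger ideals because the induction passes to colon ideals. *)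
Lemma no_zero_prod J w (s : seq K) : is_ideal J -> no_zero J ->
  (forall J', is_ideal J' -> no_zero J' -> (forall h, J h -> J' h) ->
     forall x, J' (w - x%:MP) -> J' 1) ->
  J (\prod_(x <- s) (w - x%:MP)) -> J 1.
Proof.
elim: s J => [|x s IHs] J iJ nz base; first by rewrite big_nil.
rewrite big_cons => Js; apply: (base J iJ nz (fun h Jh => Jh) x).
rewrite -[w - _]mulr1.
have sub h : J h -> J ((w - x%:MP) * h) by case: iJ => _ _; apply.
apply: (IHs (fun h => J ((w - x%:MP) * h))) => //.
- exact: colon_ideal.
- exact: no_zero_sub nz.
- move=> J' iJ' nz' JJ' y; apply: base => // h Jh.
  by apply: JJ'; apply: sub.
Qed.

End Schemes.

Section ClosedField.
Variable K : closedFieldType.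
Implicit Types (f g h u F G : {mpoly K[2]}) (I J : {mpoly K[2]} -> Prop).

Lemma nullstellensatz J (q0 q1 : {poly K}) : is_ideal J -> no_zero J ->
  q0 != 0 -> q1 != 0 -> J (peval 'X_0 q0) -> J (peval 'X_1 q1) -> J 1.
Proof.
have split_q w (q : {poly K}) J' : q != 0 -> is_ideal J' -> J' (peval w q) ->
    exists s : seq K, J' (\prod_(x <- s) (w - x%:MP)).
  move=> q0nz iJ' Jq; have [s eq_q] := closed_field_poly_normal q; exists s.
  rewrite -[\prod_(x <- s) _]scale1r -(@mulVf _ (lead_coef q)) ?lead_coef_eq0 //.
  rewrite -scalerA; apply: ideal_scale => //; move: Jq; congr J'.
  rewrite {1}eq_q linearZ rmorph_prod /=; congr (_ *: _); apply: eq_bigr => x _.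
  by rewrite rmorphB /= pevalX pevalC alg_mpolyC.
move=> iJ nz q0nz q1nz /split_q[//|//|s0 Js0] /split_q[//|//|s1 Js1].
apply: no_zero_prod Js0 => // J0 iJ0 nz0 JJ0 x J0x.
apply: no_zero_prod (JJ0 _ Js1) => // J1 iJ1 nz1 JJ1 y J1y.
exact: (no_zero_point iJ1 nz1 (JJ1 _ J0x) J1y).
Qed.

(** The ideal generated by I and u has no zero, since the only zero of I is the origin. *)
Lemma unit_mod_ideal I l u : is_ideal I -> supported_at I (orig K) -> has_length I l ->
  u@_0 != 0 -> exists w, I (w * u - 1).
Proof.
move=> iI sup len u0; have [I0 ID IM] := iI.
(* J is the ideal generated by I and u. *)
pose J h := exists w, I (h - w * u).
have IJ h : I h -> J h by exists 0; rewrite mul0r subr0.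
have iJ : is_ideal J.
  split; first exact: IJ.
    move=> g h [v Iv] [w Iw]; exists (v + w).
    by rewrite (_ : _ - _ = (g - v * u) + (h - w * u)); [apply: ID | ring].
  move=> g h [w Iw]; exists (g * w).
  by rewrite (_ : _ - _ = g * (h - w * u)); [apply: IM | ring].
have nz : no_zero J.
  move=> v; apply: NNPP => nov.
  have van h : J h -> h.@[tnth v] = 0.
    by move=> Jh; apply/eqP/negPn/negP => hv; apply: nov; exists h.
  have ev : v = orig K by apply/sup => g /IJ/van.
  have /van : J u by exists 1; rewrite mul1r subrr.
  by rewrite ev meval_orig => /eqP; rewrite (negPf u0).
have [q0 q0nz Iq0] := univariate_in_ideal 'X_0 iI len.
have [q1 q1nz Iq1] := univariate_in_ideal 'X_1 iI len.
have [w Iw] := nullstellensatz iJ nz q0nz q1nz (IJ _ Iq0) (IJ _ Iq1).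
by exists w; rewrite -opprB -sub0r; apply: ideal_sub.
Qed.

Lemma unit_cancel I l u h : is_ideal I -> supported_at I (orig K) -> has_length I l ->
  u@_0 != 0 -> I (h * u) -> I h.
Proof.
move=> iI sup len u0 Ihu; have [w Iw] := unit_mod_ideal iI sup len u0.
rewrite (_ : h = w * (h * u) - h * (w * u - 1)); last by ring.
by case: (iI) => _ _ IM; apply: ideal_sub => //; apply: IM.
Qed.

(** The scheme is contained in the graph y = x p(x) because g is the equation of this
graph times a unit, up to a power of x that lies in I. Modulo I every function
is then a polynomial in x; if f had contact k < l with the graph, x^k would
lie in I and the length would be at most k. *)
Lemma scheme_graph I l f g (lam mu : K) : is_ideal I -> supported_at I (orig K) ->
  has_length I l -> I g -> linpart g lam mu -> mu != 0 -> I f ->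
  exists p, 'X^l %| ev 'X ('X * p) f.
Proof.
move=> iI sup len Ig og mu0 If; have [_ _ IM] := iI.
have [q q0 Iq] := univariate_in_ideal 'X_0 iI len.
have [n [v [eq_q v0]]] := poly_X_unit q0.
(* The exponent n.+1, not n, guarantees a factor x, so that the remainder of g on
the graph does not disturb the coefficient of y. *)
have In : I ('X_0 ^+ n.+1).
  rewrite exprS; apply: IM; apply: (@unit_cancel I l (peval 'X_0 v)) => //.
    by rewrite mcoeff0_peval.
  by move: Iq; rewrite eq_q rmorphM rmorphXn /= pevalX.
have [p dp] := hensel og mu0 n.+1; exists p.
have sub h : exists s, h - peval 'X_0 (ev 'X ('X * p) h) = ('X_1 - 'X_0 * peval 'X_0 p) * s.
  have [s es] := @ev_taylor K {mpoly K[2]} 'X_0 'X_1 ('X_0 * peval 'X_0 p) h.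
  exists s.
  by rewrite -es ev_id (ev_morph (peval _)) /= rmorphM /= pevalX.
have Ie : I ('X_1 - 'X_0 * peval 'X_0 p).
  have [s es] := sub g; case/dvdpP: dp => w ew.
  apply: (@unit_cancel I l s) => //.
    move: mu0; have [_ <-] := linpart_coef og; apply: contra_neq => s0.
    have /(congr1 (mcoeff U_(1))) := es.
    rewrite ew rmorphM rmorphXn /= pevalX mulrC exprS mulrBl -!mulrA.
    rewrite !mcoeffB !mcoeffXiM !mnm1E /= !subr0 => ->; rewrite -s0.
    by congr _@_(_); apply/mnmP => i; rewrite mnmBE subnn mnm0E.
  rewrite -es; apply: ideal_sub => //.
  by rewrite ew rmorphM rmorphXn /= pevalX; apply: IM.
have If' : I (peval 'X_0 (ev 'X ('X * p) f)).
  have [s es] := sub f; rewrite -[peval 'X_0 _](subKr f); apply: ideal_sub => //.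
  by rewrite es; apply: ideal_mulr.
have [->|phi0] := eqVneq (ev 'X ('X * p) f) 0; first exact: dvdp0.
have [k [u [eu u0]]] := poly_X_unit phi0.
rewrite eu dvdp_mulr // dvdp_exp2l // leqNgt; apply/negP => kl.
have Ik : I ('X_0 ^+ k).
  apply: (@unit_cancel I l (peval 'X_0 u)) => //; first by rewrite mcoeff0_peval.
  by move: If'; rewrite eu rmorphM rmorphXn /= pevalX.
have : (l <= k)%N; last by rewrite leqNgt kl.
apply: (length_le_span (s := fun j : 'I_k => 'X_0 ^+ j) iI len) => h.
have [s es] := sub h; set r := ev 'X ('X * p) h in es.
exists (\row_j r`_j).
have -> : \sum_(j < k) (\row_j r`_j) 0 j *: ('X_0 : {mpoly K[2]}) ^+ j = peval 'X_0 (take_poly k r).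
  by rewrite /take_poly peval_poly; apply: eq_bigr => j _; rewrite mxE.
rewrite -{1}(subrK (peval 'X_0 r) h) es -{1}[r](poly_take_drop k) rmorphD.
rewrite [X in X - _]addrA addrAC addrK; case: (iI) => _ ID _; apply: ID.
  exact: ideal_mulr.
by rewrite rmorphM rmorphXn /= pevalX; apply: IM.
Qed.

(** The velocity of the arc, or the linear part of the smooth curve that contains the
scheme, is nonzero in one of the coordinates; after [swap] the arc or the curve
is a graph over the first axis. *)
Lemma contains_has_arc f (P : 2.-tuple K) l : (0 < l)%N ->
  contains_curvilinear f P l <-> has_arc (translate f P) l.
Proof.
move=> l0; rewrite contains_translate; set F := translate f P; split.
  case=> I [iI sup len [g /smooth_at_orig[lam [mu [og nz]]] Ig]] IF.
  have graph_arc F' p : 'X^l %| ev 'X ('X * p) F' -> has_arc F' l.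
    by move=> d; exists 1, p; rewrite mulr1 hornerC oner_neq0; split=> //; left.
  have [mu0|mu0] := eqVneq mu 0; last first.
    by have [p] := scheme_graph iI sup len Ig og mu0 IF; apply: graph_arc.
  have lam0 : lam != 0 by case: nz => //; rewrite mu0 eqxx.
  have [iI' sup' len'] := @transport_scheme K (ev _ _) (ev _ _) _ (@swapK _) (@swapK _)
    (fun g Q => meval_swap Q g) _ _ (@swap_pt K) I l iI sup len.
  have [||p dp] := @scheme_graph _ l (swap F) (swap g) mu lam iI' sup' len' _
    (linpart_swap og) lam0.
  - by rewrite /= -/(swap _) swapK.
  - by rewrite /= -/(swap _) swapK.
  by rewrite -[F]swapK; apply: has_arc_swap; apply: graph_arc dp.
case=> p [q [nz d]].
have [p0|p0] := eqVneq p.[0] 0; last first.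
  have [|r dr] := @graph_of_transversal _ F l; first by exists p, q.
  exact: graph_contains dr.
have q0 : q.[0] != 0 by case: nz => //; rewrite p0 eqxx.
rewrite -[F]swapK; apply: contains_swap.
have [|r dr] := @graph_of_transversal _ (swap F) l.
  by exists q, p; rewrite ev_swap.
exact: graph_contains dr.
Qed.

End ClosedField.

(** * The discriminant of a reduced curve *)

Section Discriminant.
Variable K : fieldType.
Implicit Types (f g h : {mpoly K[2]}) (q : {poly K}) (G : {poly {poly K}}).

(** K[x, y] as K[x][y], where the division theory of univariate polynomials over an
integral domain amounts to working over the field K(x). *)
Definition to_poly2 : {mpoly K[2]} -> {poly {poly K}} :=
  mmap (polyC \o polyC) (fun i : 'I_2 => if i == 0 then 'X%:P else 'X).

HB.instance Definition _ := GRing.RMorphism.copy to_poly2 to_poly2.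

Definition of_poly2 G : {mpoly K[2]} := (map_poly (peval 'X_0) G).['X_1].

Lemma of_poly2_monoid_morphism : monoid_morphism of_poly2.
Proof.
by split=> [|G G']; rewrite /of_poly2 ?rmorph1 ?hornerC // rmorphM hornerM.
Qed.

Lemma of_poly2_additive : {morph of_poly2 : G G' / G - G'}.
Proof. by move=> G G'; rewrite /of_poly2 rmorphB hornerD hornerN. Qed.

HB.instance Definition _ :=
  GRing.isZmodMorphism.Build {poly {poly K}} {mpoly K[2]} of_poly2 of_poly2_additive.
HB.instance Definition _ :=
  GRing.isMonoidMorphism.Build {poly {poly K}} {mpoly K[2]} of_poly2
    of_poly2_monoid_morphism.

Lemma of_poly2C q : of_poly2 q%:P = peval 'X_0 q.
Proof. by rewrite /of_poly2 map_polyC hornerC. Qed.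

Lemma of_poly2X : of_poly2 'X = 'X_1.
Proof. by rewrite /of_poly2 map_polyX hornerX. Qed.

Lemma to_poly2C (c : K) : to_poly2 c%:MP = c%:P%:P.
Proof. exact: mmapC. Qed.

Lemma to_poly2X0 : to_poly2 'X_0 = 'X%:P.
Proof. by rewrite /to_poly2 mmapX mmap1U. Qed.

Lemma to_poly2X1 : to_poly2 'X_1 = 'X.
Proof. by rewrite /to_poly2 mmapX mmap1U. Qed.

Lemma to_poly2K : cancel to_poly2 of_poly2.
Proof.
elim/mpoly2_ind => [c|||g h IHg IHh|g h IHg IHh].
- by rewrite to_poly2C of_poly2C pevalC alg_mpolyC.
- by rewrite to_poly2X0 of_poly2C pevalX.
- by rewrite to_poly2X1 of_poly2X.
- by rewrite !rmorphD /= IHg IHh.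
- by rewrite !rmorphM /= IHg IHh.
Qed.

Lemma to_poly2_peval q : to_poly2 (peval 'X_0 q) = q%:P.
Proof.
elim/poly_ind: q => [|q c IHq]; first by rewrite !rmorph0.
rewrite !(rmorphD, rmorphM) /= IHq pevalX pevalC alg_mpolyC to_poly2X0 to_poly2C.
by rewrite ?polyCD ?polyCM.
Qed.

Lemma of_poly2K : cancel of_poly2 to_poly2.
Proof.
elim/poly_ind => [|G q IHG]; first by rewrite !rmorph0.
rewrite !(rmorphD, rmorphM) /= IHG of_poly2X of_poly2C to_poly2_peval.
by rewrite to_poly2X1.
Qed.

Lemma deriv_to_poly2 h : (to_poly2 h)^`() = to_poly2 h^`M(1).
Proof.
elim/mpoly2_ind: h => [c|||g h IHg IHh|g h IHg IHh].
- by rewrite to_poly2C derivC mderivC rmorph0.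
- by rewrite to_poly2X0 derivC mderivXi rmorph0.
- by rewrite to_poly2X1 derivX mderivXi rmorph1.
- by rewrite mderivD !rmorphD /= derivD IHg IHh.
- by rewrite mderivM rmorphD !rmorphM /= derivM IHg IHh.
Qed.

Definition is_radical f := forall g n, mdivides f (g ^+ n) -> mdivides f g.

(** If d^2 divides f over K(x), say C f = e d^2 with C in K[x], then f divides
(d e)^2, hence d e, so that d divides C and has degree 0 in y. *)
Lemma reduced_separable f : [pchar K] =i pred0 -> f != 0 ->
  is_radical f -> separable_poly (to_poly2 f).
Proof.
move=> char0 f0 rad; apply/separable_polyP; split=> [u v uvF|u _ su].
  set d := gcdp u v.
  have /Pdiv.Idomain.dvdpP[[c e] /= c0 eF] : d * d %| to_poly2 f.
    by apply: dvdp_trans uvF; apply: dvdp_mul; rewrite ?dvdp_gcdl ?dvdp_gcdr.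
  have eCf : peval 'X_0 c * f = of_poly2 e * (of_poly2 d * of_poly2 d).
    by rewrite -[f]to_poly2K -of_poly2C -!rmorphM /= mul_polyC eF.
  have [|h eh] := rad (of_poly2 d * of_poly2 e) 2.
    exists (peval 'X_0 c * of_poly2 e).
    by rewrite mulrAC eCf; ring.
  have Ch : peval 'X_0 c = of_poly2 d * h.
    by apply: (mulIf f0); rewrite eCf -mulrA -eh; ring.
  rewrite -gcdp_eqp1 -/d; apply: (@dvdp_eqp1 _ d c%:P); last by rewrite polyC_eqp1.
  by rewrite -to_poly2_peval Ch rmorphM /= of_poly2K dvdp_mulr.
case E: (size u) su => [|[|k]] // _; apply/eqP => /(congr1 (fun p : {poly {poly K}} => p`_k)).
rewrite coef_deriv coef0 -mulr_natr => /eqP; rewrite mulf_eq0.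
have -> : u`_k.+1 = lead_coef u by rewrite lead_coefE E.
rewrite lead_coef_eq0 -size_poly_eq0 E /= -polyC_natr polyC_eq0.
by move/pcharf0P: char0 => ->.
Qed.

(** A Bezout relation between f and f_y over K(x), with denominators cleared. *)
Lemma reduced_discriminant f : [pchar K] =i pred0 -> f != 0 ->
  is_radical f ->
  exists q a b, q != 0 /\ peval 'X_0 q = a * f + b * f^`M(1).
Proof.
move=> char0 f0 /(reduced_separable char0 f0); rewrite separable_poly.unlock.
case/Bezout_coprimepP=> -[a b] /=; rewrite -size_poly_eq1 => /size_poly1P[q q0 eq].
exists q, (of_poly2 a), (of_poly2 b); split=> //.
by rewrite -of_poly2C -eq rmorphD !rmorphM /= deriv_to_poly2 !to_poly2K.
Qed.

End Discriminant.

(** * The strict transform at the points over a double point *)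

Section LocalBlowup.
Variable K : fieldType.
Implicit Types (f g h F G : {mpoly K[2]}) (P : 2.-tuple K) (t a b c : K).
Implicit Types (q : option K).

(** G is smooth and transversal to the exceptional line, hence the graph of a function of
x there: [hensel] yields transversal arcs of any contact, and these are pushed down. *)
Lemma blowup_simple_root F G t a b c : quadpart F a b c -> blowup_rel F t G ->
  a + b * t + c * t ^+ 2 = 0 -> b + 2 * c * t != 0 ->
  is_smooth G /\ forall l, has_arc F l.
Proof.
move=> oF rel r1 r2; have [l oG] := blowup_linpart oF rel r1.
split=> [|n]; first by exists l, (b + 2 * c * t); split=> //; right.
have [p dp] := hensel oG r2 n.
apply: (@has_arcW _ _ n n.+2); first by lia.
apply/transversal_has_arc/(push_transversal_arc rel).
by exists 1, p; rewrite mulr1 hornerC oner_neq0.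
Qed.

Lemma blowup_double_root F G t a b c : quadpart F a b c -> blowup_rel F t G ->
  a + b * t + c * t ^+ 2 = 0 -> b + 2 * c * t = 0 -> c != 0 ->
  (is_smooth G /\ forall l, has_arc F l <-> (l <= 3)%N) \/
  [/\ is_double G, forall l, has_arc F l.+2 <-> has_arc G l &
      forall m, (0 < m)%N -> has_singular_arc G m -> has_singular_arc F m.+1].
Proof.
move=> oF rel r1 r2 c0.
have oF' : quadpart F (c * t ^+ 2) (- (2 * c * t)) c.
  have eb : b = - (2 * c * t) by apply/eqP; rewrite -addr_eq0 r2.
  have ea : a = c * t ^+ 2.
    apply/eqP; rewrite -subr_eq0 -r1 eb; apply/eqP; ring.
  by rewrite -ea -eb.
have [[l [l0 oG]]|[a' [b' oG]]] := blowup_quadpart oF rel r1 r2; [left|right].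
  split=> [|n]; first by exists l, 0; split=> //; left.
  split=> [aF|n3].
    rewrite leqNgt; apply/negP => n4.
    have [p [q [p0 d]]] : has_transversal_arc G 2.
      by apply: (lift_arc_tangent oF' c0 rel) => //; apply: has_arcW aF.
    by move: d; apply/negP; apply: smooth_transversal_contact oG l0 p0.
  apply: has_arcW n3 _; apply/transversal_has_arc/(push_transversal_arc rel).
  exists 1, 0; rewrite hornerC oner_neq0; split=> //.
  by have [r [-> _]] := ev_linpart 1 0 oG; rewrite expr1 dvdp_mulr.
split; first exact: quadpart_is_double oG c0.
- move=> n; split=> [aF|aG]; last first.
    apply/transversal_has_arc/(push_transversal_arc rel).
    exact: double_has_transversal oG c0 aG.
  case: n aF => [|n] aF; last first.
    exact/transversal_has_arc/(lift_arc_tangent oF' c0 rel).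
  by exists 1, 0; rewrite expr0 dvd1p hornerC oner_neq0; split=> //; left.
- by move=> m m0; apply: push_singular_arc rel oG c0 m0.
Qed.

(** Coordinates in which the point q of the exceptional line lies in the chart
(u, v) |-> (u, u v), at height [slope q]. *)
Definition frame q h := if q is Some _ then h else swap h.
Definition slope q := if q is Some t then t else 0.

Lemma mcoeff0_frame q h : (frame q h)@_0 = h@_0.
Proof. by case: q => //=; apply: mcoeff0_swap. Qed.

Lemma frame_smooth q h : is_smooth (frame q h) <-> is_smooth h.
Proof.
by case: q => //=; split=> [/is_smooth_swap|]; rewrite ?swapK //; apply: is_smooth_swap.
Qed.

Lemma frame_double q h : is_double (frame q h) <-> is_double h.
Proof.
by case: q => //=; split=> [/is_double_swap|]; rewrite ?swapK //; apply: is_double_swap.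
Qed.

Lemma frame_arc q h l : has_arc (frame q h) l <-> has_arc h l.
Proof.
by case: q => //=; split=> [/has_arc_swap|]; rewrite ?swapK //; apply: has_arc_swap.
Qed.

Lemma frame_singular_arc q h l : has_singular_arc (frame q h) l <-> has_singular_arc h l.
Proof.
case: q => //=; split=> [/has_singular_arc_swap|]; rewrite ?swapK //.
exact: has_singular_arc_swap.
Qed.

Lemma blowup_exists F t : is_double F -> exists G, blowup_rel F t G.
Proof.
case=> a [b [c [[h1 [h2 [h3 [-> _ _ _]]]] _]]].
pose e := ev ('X_0 : {mpoly K[2]}) ('X_0 * (t%:MP + 'X_1)).
exists (e h1 + (t%:MP + 'X_1) * e h2 + (t%:MP + 'X_1) ^+ 2 * e h3).
by rewrite /blowup_rel !evE -!/(e _); ring.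
Qed.

Lemma blowup_not_divisible F t G : is_double F -> blowup_rel F t G ->
  ~ mdivides 'X_0 G.
Proof.
case=> a [b [c [oF nz]]] rel [h eG]; have [S eS] := blowup_form oF rel.
move: (congr1 (ev (0 : {poly K}) 'X) eS); rewrite {1}eG !evE mul0r mulr0 addr0 !alg_polyC => E.
have coefz i : (((a + b * t + c * t ^+ 2)%:P + 'X * ((b + 2 * c * t)%:P + 'X * c%:P))`_i : K) = 0.
  by rewrite -E coef0.
have := coefz 2; have := coefz 1; have := coefz 0.
rewrite !(coefD, coefXM, coefC) /= !addr0 !add0r => e0 e1 e2.
rewrite e2 !(mulr0, mul0r, addr0) in e1 e0; rewrite e1 mul0r addr0 in e0.
by case: nz; rewrite ?e0 ?e1 ?e2 eqxx.
Qed.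

(** Uniqueness of the strict transform. *)
Lemma mpolyXn_cancel (i : 'I_2) n m g h : ~ mdivides 'X_i g -> ~ mdivides 'X_i h ->
  'X_i ^+ n * g = 'X_i ^+ m * h -> g = h.
Proof.
wlog nm : n m g h / (n <= m)%N => [th ng nh e|ng nh].
  case/orP: (leq_total n m) => nm; first exact: th nm ng nh e.
  by apply/esym; apply: th nm nh ng (esym e).
rewrite -(subnKC nm) exprD -mulrA => /(mulfI _) => /(_ (expf_neq0 _ (mpolyX_neq0 _ i))).
case: (m - n)%N => [|k]; first by rewrite mul1r.
by move=> e; case: ng; exists ('X_i ^+ k * h); rewrite e exprS; ring.
Qed.

Lemma chart_frame f P q : frame q (f \mPo blowup_chart P q) =
  ev 'X_0 ('X_0 * 'X_1) (frame q (translate f P)).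
Proof.
case: q => [t|] /=; rewrite comp_mpoly_ev translateE.
  by rewrite ev_ev !evE !alg_mpolyC.
by rewrite /swap !ev_ev !evE !alg_mpolyC mulrC.
Qed.

Lemma frame_exc_line q h n : frame q (exc_line q ^+ n * h) = 'X_0 ^+ n * frame q h :> {mpoly K[2]}.
Proof. by case: q => //=; rewrite /swap !evE. Qed.

Lemma frame_mdivides q g : mdivides 'X_0 (frame q g) <-> mdivides (exc_line q) g.
Proof.
case: q => //=; split=> -[h e].
  by exists (swap h); rewrite -[g]swapK e {1}/swap !evE.
by exists (swap h); rewrite e {1}/swap !evE.
Qed.

Lemma frameK q : involutive (frame q).
Proof. by case: q => //=; apply: swapK. Qed.

Lemma strict_transform_exists f P q : is_double (translate f P) ->
  exists g, strict_transform f P q g.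
Proof.
move=> /(frame_double q) dF; have [G rel] := blowup_exists 0 dF.
exists (frame q G); split; last first.
  by rewrite -frame_mdivides frameK; apply: blowup_not_divisible rel.
exists 2; rewrite -[LHS](frameK q) chart_frame -[RHS](frameK q) frame_exc_line frameK.
by rewrite -rel mpolyC0 add0r.
Qed.

Lemma strict_transform_rel f P q g : is_double (translate f P) ->
  strict_transform f P q g ->
  blowup_rel (frame q (translate f P)) (slope q) (frame q (translate g (exc_point q))).
Proof.
move=> /(frame_double q) dF [[n en] ng]; have [G rel] := blowup_exists 0 dF.
have rel0 : blowup_rel (frame q (translate f P)) 0 (frame q g).
  suff -> : frame q g = G by [].
  apply: (@mpolyXn_cancel 0 n 2); rewrite ?frame_mdivides //.
    exact: blowup_not_divisible rel.
  by rewrite -frame_exc_line -en chart_frame -rel mpolyC0 add0r.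
have : ev 'X_0 ((slope q)%:MP + 'X_1) (frame q g) = frame q (translate g (exc_point q)).
  case: {rel0 en ng G rel dF} q => [t|] /=; rewrite translateE !(tnth_nth 0) /= !mpolyC0 !add0r //.
  by rewrite ev_id ev_id.
move=> <-; rewrite /blowup_rel.
have := congr1 (ev ('X_0 : {mpoly K[2]}) ((slope q)%:MP + 'X_1)) rel0.
by rewrite ev_ev !evE alg_mpolyC mpolyC0 add0r.
Qed.

End LocalBlowup.

Section TangentCases.
Variable K : closedFieldType.
Implicit Types (f g h F G : {mpoly K[2]}) (P : 2.-tuple K) (q : option K).

(** The quadratic form of f at the direction q; its zeros are the tangents. *)
Definition tangent_form (a b c : K) q :=
  if q is Some t then a + b * t + c * t ^+ 2 else c.

Lemma quadratic_roots (a b c : K) : c != 0 ->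
  exists t1 t2, [/\ a = c * (t1 * t2) & b = - (c * (t1 + t2))].
Proof.
move=> c0; pose p := Poly [:: a; b; c].
have [s es] := closed_field_poly_normal p.
have sp : size p = 3 by rewrite (@PolyK _ 0) //= .
have lp : lead_coef p = c by rewrite lead_coefE sp coef_Poly.
move: es sp; rewrite lp => es sp; have ss : size s = 2.
  by move: sp; rewrite es size_scale // size_prod_XsubC => -[].
case: s ss es => [|t1 [|t2 [|]]] // _ es; exists t1, t2.
rewrite !big_cons big_nil mulr1 in es.
have e0 : p`_0 = a by rewrite coef_Poly.
have e1 : p`_1 = b by rewrite coef_Poly.
rewrite -e0 -e1 es mulrBl !mulrBr -!polyCM.
rewrite !(coefZ, coefB, coefXM, coefMX, coefX, coefC, coefMC, coefCM) /=.
by split; ring.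
Qed.

Lemma tangent_cases f P (g : option K -> {mpoly K[2]}) : is_double (translate f P) ->
  (forall q, strict_transform f P q (g q)) ->
  let G q := translate (g q) (exc_point q) in
  (exists q1 q2, [/\ q1 != q2,
     forall q, (g q).@[tnth (exc_point q)] = 0 <-> q \in [:: q1; q2],
     is_smooth (G q1), is_smooth (G q2) & forall l, has_arc (translate f P) l]) \/
  (exists q1, (forall q, (g q).@[tnth (exc_point q)] = 0 <-> q \in [:: q1]) /\
    ((is_smooth (G q1) /\ forall l, has_arc (translate f P) l <-> (l <= 3)%N) \/
     [/\ is_double (G q1), forall l, has_arc (translate f P) l.+2 <-> has_arc (G q1) l &
      forall m, (0 < m)%N -> has_singular_arc (G q1) m ->
        has_singular_arc (translate f P) m.+1])).
Proof.
move=> dF stg G; set F := translate f P in dF *.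
have [a [b [c [oF nz]]]] := dF.
have rel q : blowup_rel (frame q F) (slope q) (frame q (G q)).
  exact: strict_transform_rel.
have oF' : quadpart (swap F) c b a by apply: quadpart_swap.
have val q : (g q).@[tnth (exc_point q)] = tangent_form a b c q.
  have -> : (g q).@[tnth (exc_point q)] = (G q)@_0.
    rewrite -meval_orig meval_translate; congr _.@[tnth _].
    by apply/tuple2_eqP; split; apply/esym; exact: addr0.
  rewrite -(mcoeff0_frame q); case: q => [t|] /=.
    by rewrite (blowup_value oF (rel (Some t))).
  by rewrite (blowup_value oF' (rel None)) /= expr0n /= !mulr0 !addr0.
have simple q : let: (a', b', c') := if q is Some _ then (a, b, c) else (c, b, a) in
    tangent_form a b c q = 0 -> b' + 2 * c' * slope q != 0 ->
    is_smooth (G q) /\ forall l, has_arc F l.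
  case: q => [t|] /= r1 r2.
    exact: (blowup_simple_root oF (rel (Some t)) r1 r2).
  have [|s1 s2] := blowup_simple_root oF' (rel None) _ r2.
    by rewrite r1 /= expr0n /= !mulr0 !addr0.
  split=> [|l]; first exact: (proj1 (frame_smooth None (G None)) s1).
  exact: (proj1 (frame_arc None F l) (s2 l)).
have double q : let: (a', b', c') := if q is Some _ then (a, b, c) else (c, b, a) in
    tangent_form a b c q = 0 -> b' + 2 * c' * slope q = 0 -> c' != 0 ->
    (is_smooth (G q) /\ forall l, has_arc F l <-> (l <= 3)%N) \/
    [/\ is_double (G q), forall l, has_arc F l.+2 <-> has_arc (G q) l &
      forall m, (0 < m)%N -> has_singular_arc (G q) m -> has_singular_arc F m.+1].
  case: q => [t|] /= r1 r2 r3.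
    exact: (blowup_double_root oF (rel (Some t)) r1 r2 r3).
  have [|[s1 s2]|[s1 s2 s3]] := blowup_double_root oF' (rel None) _ r2 r3.
  - by rewrite r1 /= expr0n /= !mulr0 !addr0.
  - left; split=> [|l]; first exact: (proj1 (frame_smooth None (G None)) s1).
    exact: iff_trans (iff_sym (frame_arc None F l)) (s2 l).
  right; split=> [|l|m m0 sG]; first exact: (proj1 (frame_double None (G None)) s1).
    apply: iff_trans (iff_sym (frame_arc None F l.+2)) _.
    exact: iff_trans (s2 l) (frame_arc None (G None) l).
  apply: (proj1 (frame_singular_arc None F m.+1)); apply: (s3 m m0).
  exact: (proj2 (frame_singular_arc None (G None) m) sG).
have [c0|c0] := eqVneq c 0.
  have [b0|b0] := eqVneq b 0.
    have a0 : a != 0 by case: nz; rewrite ?b0 ?c0 ?eqxx.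
    right; exists None; split.
      move=> q; rewrite val inE; case: q => [t|] /=; rewrite ?b0 ?c0 ?mul0r ?addr0.
        by split=> // a0'; rewrite a0' eqxx in a0.
      by rewrite eqxx.
    apply: (double None) => //=; rewrite b0; ring.
  left; exists (Some (- a / b)), None; split=> //.
  - move=> q; rewrite val !inE; case: q => [t|] /=; rewrite ?c0 ?eqxx ?orbT //.
    rewrite mul0r addr0 orbF; split=> [e|/eqP[->]]; last by rewrite mulrC mulfVK // subrr.
    apply/eqP; congr Some; apply: (mulfI b0); rewrite mulrC -[RHS]mulrC mulfVK //.
    by rewrite mulrC; apply/eqP; rewrite -addr_eq0 addrC e.
  - apply: proj1 (simple (Some (- a / b)) _ _) => /=.
      by rewrite c0 mul0r addr0 mulrC mulfVK // subrr.
    by rewrite c0 mulr0 mul0r addr0.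
  - by apply: proj1 (simple None _ _); rewrite //= mulr0 addr0.
  - by apply: proj2 (simple None _ _); rewrite //= mulr0 addr0.
have [t1 [t2 [ea eb]]] := quadratic_roots a b c0.
have fac t : a + b * t + c * t ^+ 2 = c * ((t - t1) * (t - t2)) by rewrite ea eb; ring.
have roots q : (g q).@[tnth (exc_point q)] = 0 <-> q \in [:: Some t1; Some t2].
  rewrite val !inE; case: q => [t|] /=; last by split=> // c0'; rewrite c0' eqxx in c0.
  rewrite fac; split=> [/eqP|/orP[]/eqP[->]]; last 2 first.
  - by rewrite subrr mul0r mulr0.
  - by rewrite subrr mulr0 mulr0.
  rewrite !mulf_eq0 (negPf c0) /= !subr_eq0 => /orP[]/eqP->.
    by rewrite eqxx.
  by rewrite eqxx orbT.
have [e12|n12] := eqVneq t1 t2; [right|left].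
  exists (Some t1); split.
    by move=> q; rewrite roots -e12 !inE orbb.
  apply: (double (Some t1)) => //=; first by rewrite fac subrr mul0r mulr0.
  by rewrite eb -e12; ring.
exists (Some t1), (Some t2).
have s1 : is_smooth (G (Some t1)) /\ forall l, has_arc F l.
  apply: (simple (Some t1)) => /=; first by rewrite fac subrr mul0r mulr0.
  by rewrite (_ : _ + _ = c * (t1 - t2)) ?mulf_neq0 ?subr_eq0 // eb; ring.
have s2 : is_smooth (G (Some t2)) /\ forall l, has_arc F l.
  apply: (simple (Some t2)) => /=; first by rewrite fac subrr mulr0 mulr0.
  rewrite (_ : _ + _ = c * (t2 - t1)); last by rewrite eb; ring.
  by rewrite mulf_neq0 // subr_eq0 eq_sym.
by case: s1 s2 => s1 al [s2 _]; split=> //; apply: contra n12 => /eqP[->].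
Qed.

End TangentCases.

(** * Contact along a resolution, and termination *)

Section Resolution.
Variable K : closedFieldType.
Implicit Types (f : {mpoly K[2]}) (P : 2.-tuple K).

Lemma resolves_smooth_inv f P m k :
  resolves f P m k -> smooth_at f P -> m = 0 /\ k = 1.
Proof.
case=> [//|n g s m' k' mult n1 _ _ _ _ smo].
by case: (smooth_not_singular n1 smo mult).
Qed.

(** Blow up as long as a double point with a single tangent appears. Either this stops
at a smooth point or at a point with two tangents, or the m-th double point
has a singular arc, which gains one order each time it is pushed down. *)
Lemma resolves_or_singular_arc m f P : (0 < m)%N -> is_double (translate f P) ->
  (exists d k, [/\ (0 < d)%N, k = 1 \/ k = 2 & resolves f P d k]) \/
  has_singular_arc (translate f P) m.
Proof.
elim: m f P => // m IHm f P _ dF.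
have mult : multiplicity_at f P 2 by apply/double_point_translate.
have [g stg] : exists g, forall q, strict_transform f P q (g q).
  (* All the directions Some t share one chart, hence one strict transform. *)
  have [g1 st1] := strict_transform_exists (Some 0) dF.
  have [g2 st2] := strict_transform_exists None dF.
  by exists (fun q => if q is Some _ then g1 else g2); case.
have [[q1 [q2 [q12 roots s1 s2 _]]]|[q1 [roots cases]]] := tangent_cases dF stg.
  left; exists 1, 2; split=> //; first by right.
  have := resolves_blowup (s := [:: q1; q2]) (m := fun=> 0%N) (k := fun=> 1%N)
    mult (ltnSn 1) stg.
  rewrite !big_cons !big_nil /=; apply; first by rewrite inE q12.
    by move=> q; rewrite roots.
  move=> q; rewrite !inE => /orP[]/eqP->; apply: resolves_smooth; exact/smooth_at_translate.
have up d k : resolves (g q1) (exc_point q1) d k -> resolves f P d.+1 k.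
  move=> res; have := resolves_blowup (s := [:: q1]) (m := fun=> d) (k := fun=> k)
    mult (ltnSn 1) stg.
  rewrite !big_cons !big_nil !addn0 add1n; apply=> // q; first by rewrite roots.
  by rewrite inE => /eqP->.
case: cases => [[s1 _]|[d1 _ push]].
  left; exists 1, 1; split; [by [] | by left |].
  by apply: up; apply: resolves_smooth; apply/smooth_at_translate.
case: m IHm => [_|m IHm].
  right; exists 1, 0; have [? ? ?] := double_singular_contact1 1 0 dF.
  by split=> //; left; rewrite hornerC oner_neq0.
have [[d [k [d0 k12 res]]]|sG] := IHm (g q1) (exc_point q1) isT d1.
  by left; exists d.+1, k; split=> //; apply: up.
by right; apply: push.
Qed.

(** Each blow-up at a double point with one tangent shifts the possible orders of contact
by 2; the last one starts from all orders, or from the orders up to 3. *)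
Lemma resolves_arcs f P d k : resolves f P d k -> is_double (translate f P) ->
  (k = 1 -> forall l, has_arc (translate f P) l <-> (l <= 2 * d + 1)%N) /\
  (k = 2 -> forall l, has_arc (translate f P) l).
Proof.
elim=> {f P d k} [f P smo /double_point_translate dF|f P n g s m k mult n1 stg us memS res IH dF].
  by case: (smooth_not_singular (n := 2) _ smo).
have perm_s s' : uniq s' -> (forall q, (g q).@[tnth (exc_point q)] = 0 <-> q \in s') ->
    perm_eq s s'.
  move=> us' roots; apply: uniq_perm => // q.
  by apply/idP/idP => [/memS/roots|/roots/memS].
have [[q1 [q2 [q12 roots s1 s2 al]]]|[q1 [roots cases]]] := tangent_cases dF stg.
  have ps : perm_eq s [:: q1; q2] by apply: perm_s => //=; rewrite inE q12.
  have inv q : q \in s -> is_smooth (translate (g q) (exc_point q)) -> k q = 1%N.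
    by move=> qs /smooth_at_translate sm; have [] := resolves_smooth_inv (res q qs) sm.
  rewrite !(perm_big _ ps) /= !big_cons !big_nil.
  rewrite !inv ?(perm_mem ps) ?inE ?eqxx ?orbT //.
have ps : perm_eq s [:: q1] by apply: perm_s.
rewrite !(perm_big _ ps) /= !big_cons !big_nil !addn0.
have q1s : q1 \in s by rewrite (perm_mem ps) inE.
case: cases => [[s1 a3]|[d1 push _]].
  have [-> ->] := resolves_smooth_inv (res _ q1s) ((smooth_at_translate _ _).2 s1).
  by [].
have [IH1 IH2] := IH _ q1s d1.
have small l : (l < 2)%N -> has_arc (translate f P) l.
  move=> l2; apply: (has_arcW (l := 2)); first exact: ltnW.
  apply/push; exists 1, 0; rewrite expr0 dvd1p; split=> //.
  by left; rewrite hornerC oner_neq0.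
split=> [k1 [|[|l]]|k2 [|[|l]]]; try by split=> // _; apply: small.
- by rewrite push IH1 //; split; lia.
- exact: small.
- exact: small.
- by apply/push; apply: IH2.
Qed.

End Resolution.

Section Bound.
Variable K : fieldType.
Implicit Types (f g h : {mpoly K[2]}) (P : 2.-tuple K).

(** With a f + b f_y = r(x) and r nonzero, the order of f and f_y along the arc is at
most the order of r at the abscissa of P, because x is a local parameter. *)
Lemma transversal_singular_bound f P : [pchar K] =i pred0 -> f != 0 ->
  is_radical f ->
  exists M, forall m p q, p.[0] != 0 ->
    'X^m %| ev ('X * p) ('X * q) (translate f P) ->
    'X^m %| ev ('X * p) ('X * q) (translate f P)^`M(1) -> (m <= M)%N.
Proof.
move=> char0 f0 rad; have [r [a [b [r0 er]]]] := reduced_discriminant char0 f0 rad.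
have r0' : r \Po ('X + (tnth P 0)%:P) != 0 by rewrite comp_poly2_eq0 // size_XaddC.
have [k [v [ev_r v0]]] := poly_X_unit r0'; exists k => m p q p0 dF dF1.
have eF1 : (translate f P)^`M(1) = translate f^`M(1) P.
  rewrite !translateE mderiv_ev !mderivD !mderivC !mderivXi /=.
  by rewrite !add0r mulr0 mulr1 add0r.
have := congr1 (fun h => ev ('X * p) ('X * q) (translate h P)) er.
rewrite eF1 in dF1; rewrite /= !translateE in dF dF1 *.
rewrite [ev _ _ (_ + _)]evD ![ev _ _ (_ * _)]evM [ev _ _ (_ + _)]evD ![ev _ _ (ev _ _ _ * _)]evM.
rewrite (peval_morph (ev _ _)) /= (peval_morph (ev _ _)) /= !evE alg_polyC peval_comp.
have -> : (tnth P 0)%:P + 'X * p = ('X + (tnth P 0)%:P) \Po ('X * p).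
  by rewrite comp_polyD comp_polyX comp_polyC addrC.
rewrite comp_polyA ev_r comp_polyM (rmorphXn (comp_poly _)) /= comp_polyX exprMn -mulrA => e.
have : 'X^m %| 'X^k * (p ^+ k * (v \Po ('X * p))).
  by rewrite e; apply: dvdp_add; apply: dvdp_mull.
apply: dvdXn_unit; rewrite hornerM mulf_neq0 //.
  by rewrite horner_exp expf_neq0.
by rewrite horner_comp hornerX0.
Qed.

Lemma translate_swap f P : swap (translate f P) = translate (swap f) [tuple tnth P 1; tnth P 0].
Proof. by rewrite !translateE ev_swap /swap ev_ev !evE !alg_mpolyC. Qed.

Lemma radical_swap f : is_radical f -> is_radical (swap f).
Proof.
move=> rad g n [h e]; have [|h' e'] := rad (swap g) n.
  by exists (swap h); rewrite -[f]swapK /swap -!(evM, evXn) -/(swap _) e.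
by exists (swap h'); rewrite -[g]swapK e' {1}/swap evM.
Qed.

Lemma singular_arc_bound f P : [pchar K] =i pred0 -> reduced_curve f ->
  exists M, (0 < M)%N /\ ~ has_singular_arc (translate f P) M.
Proof.
move=> char0 [nt rad].
have f0 : f != 0 by apply: contraTneq nt => ->; rewrite msize0.
have sf0 : swap f != 0.
  by apply: contra f0 => /eqP e; rewrite -[f]swapK e /swap ev0.
have [M1 b1] := transversal_singular_bound P char0 f0 rad.
have [M2 b2] := transversal_singular_bound [tuple tnth P 1; tnth P 0] char0 sf0 (radical_swap rad).
exists (maxn M1 M2).+1; split=> // -[p [q [nz d d0 d1]]].
have [p0|p0] := eqVneq p.[0] 0; last first.
  have := b1 _ _ _ p0 (dvdXnW (leqnSn _) d) d1; lia.
have q0 : q.[0] != 0 by case: nz => //; rewrite p0 eqxx.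
have := b2 (maxn M1 M2).+1 q p q0; rewrite -translate_swap ev_swap => /(_ (dvdXnW (leqnSn _) d)).
rewrite /swap mderiv_ev !mderivXi /= mulr0 mulr1 addr0 ev_ev evX0 evX1 => /(_ d0); lia.
Qed.

End Bound.

Lemma double_point_resolves (K : closedFieldType) (f : {mpoly K[2]}) (P : 2.-tuple K) :
  [pchar K] =i pred0 -> reduced_curve f -> double_point f P ->
  exists d k, [/\ (0 < d)%N, k = 1 \/ k = 2 & resolves f P d k].
Proof.
move=> char0 red /double_point_translate dF; have [M [M0 noM]] := singular_arc_bound P char0 red.
by have [] := resolves_or_singular_arc M0 dF.
Qed.

Lemma resolves_contains (K : closedFieldType) (f : {mpoly K[2]}) (P : 2.-tuple K) d k :
  double_point f P -> resolves f P d k ->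
  (k = 1 -> forall l, (0 < l)%N -> contains_curvilinear f P l <-> (l <= 2 * d + 1)%N) /\
  (k = 2 -> forall l, (0 < l)%N -> contains_curvilinear f P l).
Proof.
move=> /double_point_translate dF res; have [a1 a2] := resolves_arcs res dF.
split=> ek l l0; rewrite contains_has_arc //; [exact: a1 | exact: a2].
Qed.

Local Open Scope complex_scope.

Theorem theorem2p3 (R : realType) (f : {mpoly R[i][2]}) (P : 2.-tuple R[i])
    (f_reduced : reduced_curve f) (P_double : double_point f P) :
  [/\ (exists r : nat, (0 < r)%N /\ A_singularity f P (2 * r)) <->
      (exists r : nat, (0 < r)%N /\
         forall l : nat, (2 * r + 1 < l)%N -> ~ contains_curvilinear f P l),
      (exists r : nat, (0 < r)%N /\ A_singularity f P (2 * r - 1)) <->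
      (forall l : nat, (1 <= l)%N -> contains_curvilinear f P l)
    & forall r : nat, (0 < r)%N ->
      A_singularity f P (2 * r) <->
      (forall l : nat, (1 <= l <= 2 * r + 1)%N -> contains_curvilinear f P l) /\
      (forall l : nat, (2 * r + 1 < l)%N -> ~ contains_curvilinear f P l)].
Proof.
have even_A r : (0 < r)%N -> A_singularity f P (2 * r) ->
    forall l, (0 < l)%N -> contains_curvilinear f P l <-> (l <= 2 * r + 1)%N.
  move=> r0 [_ [m [e [m0 em res]]]].
  have e0 : e = false by case: e em {res} => //; lia.
  have -> : r = m by move: em; rewrite e0; lia.
  by rewrite e0 in res; apply: (resolves_contains P_double res).1.
have odd_A r : (0 < r)%N -> A_singularity f P (2 * r - 1) ->
    forall l, (0 < l)%N -> contains_curvilinear f P l.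
  move=> r0 [_ [m [e [m0 em res]]]].
  have e1 : e = true by case: e em {res} => //; lia.
  by rewrite e1 in res; apply: (resolves_contains P_double res).2.
have [d [k [d0 k12 res_k]]] :=
  double_point_resolves (@Num.Theory.pchar_num R[i]) f_reduced P_double.
have cases :
    (resolves f P d 1 /\
      forall l, (0 < l)%N -> contains_curvilinear f P l <-> (l <= 2 * d + 1)%N) \/
    (resolves f P d 2 /\ forall l, (0 < l)%N -> contains_curvilinear f P l).
  have [c1 c2] := resolves_contains P_double res_k.
  by case: k12 => ek; rewrite ek in res_k; [left | right]; split; auto.
have mk_even : resolves f P d 1 -> A_singularity f P (2 * d).
  by move=> res; split=> //; exists d, false; split=> //; lia.
split.
- split=> [[r [r0 /(even_A _ r0) c]]|[r [r0 c]]].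
    by exists r; split=> // l rl; rewrite c; lia.
  case: cases => [[res _]|[_ al]]; first by exists d; split=> //; apply: mk_even.
  by case: (c (2 * r + 2)%N); [lia | apply: al; lia].
- split=> [[r [r0 /(odd_A _ r0) c]] //|al].
  case: cases => [[_ c]|[res _]].
    by have := al (2 * d + 2)%N; rewrite c; lia.
  by exists d; split=> //; split=> //; exists d, true.
- move=> r r0; split=> [/(even_A _ r0) c|[c1 c2]].
    split=> l; first by case/andP=> l0 lr; apply/c.
    by move=> rl; rewrite c; lia.
  case: cases => [[res c]|[_ al]]; last first.
    by case: (c2 (2 * r + 2)%N); [lia | apply: al; lia].
  suff -> : r = d by apply: mk_even.
  have : (2 * r + 1 <= 2 * d + 1)%N by rewrite -c; [apply: c1|]; lia.
  have : ~ (2 * r + 1 < 2 * d + 1)%N by move=> lt; case: (c2 _ lt); apply/c; lia.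
  lia.
Qed.
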